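(* The following problem can be solved in polynomial time: given a separable permutation $\sigma$ and an arbitrary permutation $\tau$, compute a longest common pattern of $\sigma$ and $\tau$.
   Context: A permutation $\pi=\pi_1\cdots\pi_k$ is a pattern of $\sigma=\sigma_1\cdots\sigma_n$ if there are indices $i_1<\dots<i_k$ with $\sigma_{i_\ell}<\sigma_{i_m}$ whenever $\pi_\ell<\pi_m$. A longest common pattern of $\sigma$ and $\tau$ is a permutation of maximum length that is a pattern of both $\sigma$ and $\tau$. A permutation is separable if it involves neither $3\,1\,4\,2$ nor $2\,4\,1\,3$ as a pattern. *)

(* Defs.v *)
From mathcomp Require Import all_boot.
Set Implicit Arguments. Unset Strict Implicit. Unset Printing Implicit Defensive.

Definition is_perm (s : seq nat) : Prop := perm_eq s (iota 1 (size s)).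

Definition order_iso (s t : seq nat) : Prop :=
  size s = size t /\
  forall l m, l < size s -> m < size s ->
    (nth 0 s l < nth 0 s m) = (nth 0 t l < nth 0 t m).

Definition is_pattern (pi sigma : seq nat) : Prop :=
  exists2 s, subseq s sigma & order_iso pi s.

Definition separable (sigma : seq nat) : Prop :=
  ~ is_pattern [:: 3; 1; 4; 2] sigma /\ ~ is_pattern [:: 2; 4; 1; 3] sigma.

Definition is_LCP (pi sigma tau : seq nat) : Prop :=
  [/\ is_perm pi, is_pattern pi sigma, is_pattern pi tau &
      forall rho, is_perm rho -> is_pattern rho sigma -> is_pattern rho tau ->
        size rho <= size pi].

(* ---------- Model of computation: unit-cost RAM ----------
   Registers indexed by nat, holding nats; only addition and truncated
   subtraction (no multiplication), with indirect addressing.  This model is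
   polynomially equivalent to Turing machines. *)
Inductive instr :=
| IConst (r c : nat)
| IAdd   (r a b : nat)
| ISub   (r a b : nat)
| ILoad  (r a : nat)
| IStore (a b : nat)
| IJz    (r l : nat)
| IJmp   (l : nat)
| IHalt.

Definition program := seq instr.

Record config := Config { pc : nat; mem : nat -> nat }.

Definition upd (m : nat -> nat) (r v : nat) : nat -> nat :=
  fun x => if x == r then v else m x.

(* one step; a program counter outside the program means Halt *)
Definition step (p : program) (c : config) : config :=
  let m := mem c in
  let k := pc c in
  match nth IHalt p k with
  | IConst r v => Config k.+1 (upd m r v)
  | IAdd r a b => Config k.+1 (upd m r (m a + m b))
  | ISub r a b => Config k.+1 (upd m r (m a - m b))
  | ILoad r a => Config k.+1 (upd m r (m (m a)))
  | IStore a b => Config k.+1 (upd m (m a) (m b))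
  | IJz r l => Config (if m r == 0 then l else k.+1) m
  | IJmp l => Config l m
  | IHalt => c
  end.

Definition halted (p : program) (c : config) : bool :=
  if nth IHalt p (pc c) is IHalt then true else false.

Definition init (x : seq nat) : config := Config 0 (fun i => nth 0 x i).

(* configuration after t steps (halted configurations are fixed points) *)
Definition run (p : program) (x : seq nat) (t : nat) : config := iter t (step p) (init x).

Definition output (c : config) : seq nat := mkseq (fun i => mem c i.+1) (mem c 0).

Definition encode (sigma tau : seq nat) : seq nat :=
  [:: size sigma, size tau & sigma ++ tau].

(* Main.v *)
Require Import Defs.
From mathcomp Require Import all_boot.
From mathcomp Require Import zify.
Set Implicit Arguments. Unset Strict Implicit. Unset Printing Implicit Defensive.

(** The search is a dynamic program over pairs of rectangles, one in the plot of [sigma] and one in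
    the plot of [tau].  A permutation of length at least two that avoids 2413 and 3142 is a direct
    or a skew sum of two shorter ones, and a common pattern lying in a pair of rectangles that
    splits in this way splits both rectangles at a point.  So the best value of a pair of rectangles
    is the maximum over all cuts of the sum of the best values of the two parts; no separating tree
    of [sigma] is needed, only the fact that all its patterns are separable.

    The entry of [sigma] at position [p] has weight [2 ^ Z + 2 ^ (Z - 1 - p)], with [Z] larger than
    both lengths.  The weight of a set of positions then determines its size (the part above
    [2 ^ Z]) and its elements (the bits below), so that maximising a single number both compares
    sizes and records a witness, which is read off the final value bit by bit.  The table is filled
    by saturation: [Z] times, every entry is raised to the sum of its parts, for every cut. *)

(** * Patterns and separability *)

(** Saturation dispenses with an order of evaluation on the boxes. Two invariants control it: at
    every moment an entry is the weight of an actual matching inside its boxes, and after [r] rounds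
    it is at least every value derivable with at most [r] nested cuts. When a matching with two or
    more points is cut, both parts have fewer points, so a depth one above the number of points is
    enough, and this is at most [Z]. The weights replace back pointers: a maximum carries its own
    witness. Only positions of [sigma] are recorded, since the pattern is the standardization of the
    entries found there. Entries stay below [Z * 2 ^ Z], so the numbers have polynomially many bits
    and unit cost is not abused. The machine shapes the rest. It has only addition and truncated
    subtraction, so a product by [Z] is a loop, maxima and tests are truncated differences, and bits
    are read from the top by doubling. Moreover the input lies where the registers should be. *)

(* 3142 when [R] is [<], and 2413 when [R] is [>]. *)
Definition avoids (R : rel nat) (s : seq nat) : Prop :=
  forall a b c d, subseq [:: a; b; c; d] s -> R b d -> R d a -> R a c -> False.

Definition splits (R : rel nat) (s : seq nat) : Prop :=
  exists u v, [/\ s = u ++ v, u != [::], v != [::] & allrel R u v].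

Lemma avoids_sub R s t : subseq s t -> avoids R t -> avoids R s.
Proof. by move=> st H a b c d abcd; apply: H; apply: subseq_trans st. Qed.

(* If [u] is [p] followed by a smaller [q], and [x] lies strictly between two entries of [u], then
   some [a'] of [p] above [x], some [b'] of [q] below [x], the head of [v] and [x] form a 3142. *)
Lemma splits_rcons (R R' : rel nat) :
  transitive R -> (forall x y, R' x y = R y x) ->
  (forall x y, x != y -> R x y || R y x) ->
  forall m, (forall s, size s <= m -> 1 < size s -> uniq s -> avoids R s -> avoids R' s ->
               splits R s \/ splits R' s) ->
  forall k u v x, size u <= k -> size u <= m -> uniq (rcons (u ++ v) x) ->
    u != [::] -> v != [::] -> allrel R u v ->
    avoids R (rcons (u ++ v) x) -> avoids R' (rcons (u ++ v) x) ->
  splits R (rcons (u ++ v) x) \/ splits R' (rcons (u ++ v) x).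
Proof.
move=> Rtr R'E Rtot m IH; elim=> [|k IHk] u v x uk um uq u0 v0 Ruv av av'.
  by case: u uk u0 {um uq Ruv av av'}.
have xu y : y \in u -> y != x.
  move: uq; rewrite rcons_uniq mem_cat negb_or => /andP[/andP[xNu _] _] yu.
  by apply: contraNneq xNu => <-.
have [ux|] := boolP (all (fun y => R y x) u).
  left; exists u, (rcons v x); split=> //; first by rewrite rcons_cat.
    by case: (v) v0.
  by rewrite -cats1 allrel_catr Ruv allrel1r.
case/allPn => a au /negbTE aNx.
have xa : R x a by have := Rtot _ _ (xu _ au); rewrite aNx.
have [ux|] := boolP (all (fun y => R x y) u).
  right; exists (u ++ v), [:: x]; split=> //; first by rewrite cats1.
    by case: (u) u0.
  apply/allrelP => y z; rewrite inE mem_cat => yuv /eqP ->; rewrite R'E.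
  case/orP: yuv => [yu|yv]; first exact: (allP ux).
  by apply: (Rtr a) => //; apply: (allrelP Ruv).
case/allPn => b bu /negbTE bNx.
have bx : R b x by have := Rtot _ _ (xu _ bu); rewrite bNx orbF.
have sub_u : subseq u (rcons (u ++ v) x) by rewrite rcons_cat prefix_subseq.
have u1 : 1 < size u.
  case: u au bu {IHk uk um uq u0 Ruv av av' xu sub_u} => [|c [|]] //=; rewrite !inE => /eqP <- /eqP E.
  by rewrite -E bx in aNx.
have /IH : size u <= m by [].
move/(_ u1 (subseq_uniq sub_u uq) (avoids_sub sub_u av) (avoids_sub sub_u av')).
case=> -[p [q [uE p0 q0 pq]]].
  (* When [u] splits in the same direction as [u ++ v], its second block [q] joins [v]. The first
     block gets shorter, which is what the bound [k] measures. *)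
  have := IHk p (q ++ v) x; rewrite catA -uE; apply=> //.
  - have q1 : 0 < size q by case: (q) q0.
    by rewrite -ltnS; apply: leq_trans uk; rewrite uE size_cat -addn1 leq_add2l.
  - by apply: leq_trans um; rewrite uE size_cat leq_addr.
  - by case: (q) q0.
  - by rewrite allrel_catr pq; move: Ruv; rewrite uE allrel_catl => /andP[].
have [a' a'p xa'] : exists2 a', a' \in p & R x a'.
  have [//|] := boolP (has (fun y => R x y) p); first by move/hasP.
  move=> /hasPn H; suff : R a x by rewrite aNx.
  have px y : y \in p -> R y x.
    move=> yp; have yu : y \in u by rewrite uE mem_cat yp.
    by have := Rtot _ _ (xu _ yu); rewrite (negbTE (H _ yp)) orbF.
  move: au; rewrite uE mem_cat => /orP[/px//|aq].
  case: (p) p0 px pq => // y p' _ px pq.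
  by apply: (Rtr y); [move/allrelP: pq => /(_ y a); rewrite inE eqxx R'E; apply | apply: px; rewrite inE eqxx].
have [b' b'q xb'] : exists2 b', b' \in q & R b' x.
  have [//|] := boolP (has (fun y => R y x) q); first by move/hasP.
  move=> /hasPn H; suff : R x b by rewrite bNx.
  have qx y : y \in q -> R x y.
    move=> yq; have yu : y \in u by rewrite uE mem_cat yq orbT.
    by have := Rtot _ _ (xu _ yu); rewrite (negbTE (H _ yq)).
  move: bu; rewrite uE mem_cat => /orP[bp|/qx//].
  case: (q) q0 qx pq => // y q' _ qx pq.
  by apply: (Rtr y); [apply: qx; rewrite inE eqxx | move/allrelP: pq => /(_ b y); rewrite inE eqxx R'E; apply].
case: v v0 Ruv av {IHk av' sub_u uq} => // y v' _ Ruv av.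
case: (av a' b' y x) => //.
  rewrite uE -cats1 -!catA -[_ :: _]/([:: a'] ++ [:: b'] ++ [:: y] ++ [:: x]).
  by do !apply: cat_subseq; rewrite ?sub1seq ?inE ?eqxx.
by apply: (allrelP Ruv); rewrite ?uE ?mem_cat ?a'p // inE eqxx.
Qed.

(** The last entry is removed, the rest is split by induction, and [splits_rcons] puts the entry
    back. The skew case is the direct one with [ltn] and [gtn] exchanged. *)
Lemma splits_avoids s : 1 < size s -> uniq s -> avoids ltn s -> avoids gtn s ->
  splits ltn s \/ splits gtn s.
Proof.
have [m] := ubnP (size s); elim: m s => // m IHm s.
case/lastP: s => // s x; rewrite size_rcons !ltnS => sm s0 uq av av'.
have [s1|s1] := leqP (size s) 1.
  case: s sm s0 uq av av' s1 => [|y [|]] //= _ _ uq _ _ _.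
  rewrite inE andbT in uq.
  case: (ltngtP y x) uq => // xy _; [left|right]; exists [:: y], [:: x]; split=> //;
    by rewrite allrel1l /= xy.
have sub : subseq s (rcons s x) by rewrite -cats1 prefix_subseq.
have IH t : size t <= m.-1 -> 1 < size t -> uniq t -> avoids ltn t -> avoids gtn t ->
    splits ltn t \/ splits gtn t by move=> tm; apply: IHm; lia.
have [] := IHm s sm s1 (subseq_uniq sub uq) (avoids_sub sub av) (avoids_sub sub av').
  case=> u [v [E u0 v0 uv]]; subst s.
  have um : size u <= m.-1 by move: sm v0; rewrite size_cat; case: (v) => //= *; lia.
  apply: (@splits_rcons ltn gtn _ _ _ m.-1 IH (size u)) => //=.
  - by move=> ? ? ?; apply: ltn_trans.
  - by move=> y z; rewrite -neq_ltn.
case=> u [v [E u0 v0 uv]]; subst s.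
have um : size u <= m.-1 by move: sm v0; rewrite size_cat; case: (v) => //= *; lia.
apply/or_comm; apply: (@splits_rcons gtn ltn _ _ _ m.-1 _ (size u)) => //=.
- by move=> a b c /= ? ?; lia.
- by move=> y z; rewrite orbC -neq_ltn.
- by move=> t *; apply/or_comm; apply: IH.
Qed.

(** * Cuts of pairs of rectangles *)

(* A pair of rectangles is a list [i; j; a; b; i'; j'; a'; b']: positions in [[i, j[] with values in
   [[a, b[] for the first permutation, and likewise with primes for the second.  A list of length 12
   has in addition a point of each rectangle, [k; c; k'; c']; the index lists below extract from it
   the whole pair of rectangles and the parts of its direct and skew cuts at these points. *)
Definition sel (ix us : seq nat) : seq nat := map (nth 0 us) ix.

Definition whole := [:: 0; 1; 2; 3; 4; 5; 6; 7].
Definition sum1 := [:: 0; 8; 2; 9; 4; 10; 6; 11].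
Definition sum2 := [:: 8; 1; 9; 3; 10; 5; 11; 7].
Definition skew1 := [:: 0; 8; 9; 3; 4; 10; 11; 7].
Definition skew2 := [:: 8; 1; 2; 9; 10; 5; 6; 11].

(** The inequalities placing the cut points inside their rectangles, kept as data so that the
    machine test [guard] is generated from the same list. *)
Definition cut_pairs :=
  [:: (0, 8); (8, 1); (2, 9); (9, 3); (4, 10); (10, 5); (6, 11); (11, 7)].

Definition cut_ok (us : seq nat) : bool :=
  all (fun xy => nth 0 us xy.1 <= nth 0 us xy.2) cut_pairs.

(** A pair of numbers matches a position of the first permutation with one of the second. Lists of
    matched positions that are pairwise [compat] are the occurrences of common patterns. *)
Definition compat (f g : nat -> nat) (x y : nat * nat) : bool :=
  [&& x.1 < y.1, x.2 < y.2 &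
      ((f x.1 < f y.1) && (g x.2 < g y.2)) || ((f y.1 < f x.1) && (g y.2 < g x.2))].

Definition in_box (f g : nat -> nat) (vs : seq nat) (x : nat * nat) : bool :=
  if vs is [:: i; j; a; b; i'; j'; a'; b'] then
    [&& i <= x.1 < j, a <= f x.1 < b, i' <= x.2 < j' & a' <= g x.2 < b']
  else false.

Definition matching (f g : nat -> nat) (P : pred (nat * nat)) (vs : seq nat)
    (ps : seq (nat * nat)) : bool :=
  [&& pairwise (compat f g) ps, all P ps & all (in_box f g vs) ps].

Definition weight (w : nat -> nat) (ps : seq (nat * nat)) : nat := \sum_(x <- ps) w x.1.

Definition unit_box (f g : nat -> nat) (x : nat * nat) : seq nat :=
  [:: x.1; x.1.+1; f x.1; (f x.1).+1; x.2; x.2.+1; g x.2; (g x.2).+1].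

(** The values that [r] rounds of saturation are bound to reach. A single point is available only in
    its unit boxes, so larger boxes obtain it through cuts. *)
Inductive derives (f g : nat -> nat) (P : pred (nat * nat)) (w : nat -> nat) :
    nat -> seq nat -> nat -> Prop :=
| derives0 r vs : derives f g P w r vs 0
| derives1 r x : P x -> derives f g P w r (unit_box f g x) (w x.1)
| derives_sum r us w1 w2 : size us = 12 -> cut_ok us ->
    derives f g P w r (sel sum1 us) w1 -> derives f g P w r (sel sum2 us) w2 ->
    derives f g P w r.+1 (sel whole us) (w1 + w2)
| derives_skew r us w1 w2 : size us = 12 -> cut_ok us ->
    derives f g P w r (sel skew1 us) w1 -> derives f g P w r (sel skew2 us) w2 ->
    derives f g P w r.+1 (sel whole us) (w1 + w2).

Lemma derives_leq f g P w r r' vs v :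
  r <= r' -> derives f g P w r vs v -> derives f g P w r' vs v.
Proof.
move=> rr' D; elim: D r' rr' => {r vs v}.
- by move=> *; apply: derives0.
- by move=> *; apply: derives1.
- by move=> r us w1 w2 us12 ok _ IH1 _ IH2 [//|r'] rr'; apply: derives_sum; auto.
- by move=> r us w1 w2 us12 ok _ IH1 _ IH2 [//|r'] rr'; apply: derives_skew; auto.
Qed.

Lemma size12 (us : seq nat) : size us = 12 ->
  exists i j a b i' j' a' b' k c k' c', us = [:: i; j; a; b; i'; j'; a'; b'; k; c; k'; c'].
Proof. by case: us => [|i[|j[|a[|b[|i'[|j'[|a'[|b'[|k[|c[|k'[|c'[|]]]]]]]]]]]]] //= _; do 12 eexists. Qed.

(** The cut points separate the parts in all four coordinates, so any point of one is compatible
    with any point of the other; [cut_ok] keeps the parts inside the whole. *)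
Lemma matching_cut f g P us :
  size us = 12 -> cut_ok us -> forall ps1 ps2,
  (matching f g P (sel sum1 us) ps1 /\ matching f g P (sel sum2 us) ps2) \/
  (matching f g P (sel skew1 us) ps1 /\ matching f g P (sel skew2 us) ps2) ->
  matching f g P (sel whole us) (ps1 ++ ps2).
Proof.
case/size12=> i [j [a [b [i' [j' [a' [b' [k [c [k' [c' ->]]]]]]]]]]].
rewrite /cut_ok /= => ok ps1 ps2 H.
rewrite /matching pairwise_cat !all_cat.
case: H => -[/and3P[-> -> /allP b1] /and3P[-> -> /allP b2]]; rewrite !andbT /=;
  (apply/and3P; split;
    [ apply/allrelP=> x y /b1 /and4P[/andP[? ?] /andP[? ?] /andP[? ?] /andP[? ?]]
        /b2 /and4P[/andP[? ?] /andP[? ?] /andP[? ?] /andP[? ?]]; rewrite /compat; lia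
    | apply/allP=> x /b1 /and4P[/andP[? ?] /andP[? ?] /andP[? ?] /andP[? ?]]; rewrite /in_box; lia
    | apply/allP=> x /b2 /and4P[/andP[? ?] /andP[? ?] /andP[? ?] /andP[? ?]]; rewrite /in_box; lia ]).
Qed.

(** The cut is placed just above the largest value on the left. It serves for both positions and
    both values. *)
Lemma cut_point (T : eqType) (F : T -> nat) a b (xs ys : seq T) : xs != [::] -> ys != [::] ->
  allrel (fun x y => F x < F y) xs ys ->
  all (fun x => a <= F x < b) xs -> all (fun x => a <= F x < b) ys ->
  exists c, [/\ a <= c, c <= b, all (fun x => a <= F x < c) xs & all (fun y => c <= F y < b) ys].
Proof.
move=> x0 y0 xy /allP xb /allP yb; exists (\max_(x <- xs) (F x).+1).
have H x : x \in xs -> F x < \max_(x <- xs) (F x).+1.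
  by move=> xx; apply: (@leq_bigmax_seq _ _ _ (fun x => (F x).+1)).
have Hy y : y \in ys -> \max_(x <- xs) (F x).+1 <= F y.
  by move=> yy; apply/bigmax_leqP_seq => x xx _; apply: (allrelP xy).
split.
- case: (xs) x0 H xb => // x xs' _ H xb.
  have /xb/andP[ax _] : x \in x :: xs' by rewrite inE eqxx.
  by apply: leq_trans ax _; apply/ltnW/H; rewrite inE eqxx.
- case: (ys) y0 Hy yb => // y ys' _ Hy yb.
  have yy : y \in y :: ys' by rewrite inE eqxx.
  by apply: leq_trans (Hy _ yy) _; case/andP: (yb _ yy) => _ /ltnW.
- by apply/allP => x xx; rewrite H // andbT; case/andP: (xb _ xx).
- by apply/allP => y yy; rewrite Hy //; case/andP: (yb _ yy).
Qed.

Lemma compat_lt f g x y : compat f g x y -> (f x.1 < f y.1) = (g x.2 < g y.2).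
Proof. by case/and3P=> _ _; lia. Qed.

Lemma compat_gt f g x y : compat f g x y -> (f y.1 < f x.1) = (g y.2 < g x.2).
Proof. by case/and3P=> _ _; lia. Qed.

(** The values of the first permutation along the matching form a separable sequence, hence split;
    compatibility transfers the split to the second permutation, and [cut_point] turns it into a
    cut. Both parts are nonempty, so the depth bound drops. *)
Lemma derives_matching (f g : nat -> nat) P w :
  (forall ps : seq (nat * nat), pairwise (compat f g) ps -> all P ps ->
    avoids ltn (map (f \o fst) ps) /\ avoids gtn (map (f \o fst) ps)) ->
  forall vs ps, size vs = 8 -> matching f g P vs ps ->
  derives f g P w (size ps).+1 vs (weight w ps).
Proof.
move=> av vs ps; have [m] := ubnP (size ps); elim: m vs ps => // m IH.
case=> [|i[|j[|a[|b[|i'[|j'[|a'[|b'[|]]]]]]]]] //= ps pm _ /and3P[pw Pp bx].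
case: ps pw Pp bx pm => [|x [|y ps]].
- by rewrite /weight big_nil => *; apply: derives0.
- rewrite /weight big_seq1 /= => _ /andP[Px _] /andP[/and4P[? ? ? ?] _] _.
  (* A point is isolated by two cuts, one at its own coordinates and one just past them: hence depth
     two for one point. *)
  have D1 : derives f g P w 1
      [:: i; x.1.+1; a; (f x.1).+1; i'; x.2.+1; a'; (g x.2).+1] (0 + w x.1).
    apply: (@derives_sum f g P w 0 [:: i; x.1.+1; a; (f x.1).+1; i'; x.2.+1; a'; (g x.2).+1;
      x.1; f x.1; x.2; g x.2]) => //.
    + by rewrite /cut_ok /=; lia.
    + exact: derives0.
    + exact: derives1.
  rewrite -[w _]addn0 -[w _]add0n.
  apply: (@derives_sum f g P w 1 [:: i; j; a; b; i'; j'; a'; b'; x.1.+1; (f x.1).+1; x.2.+1; (g x.2).+1]) => //.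
  + by rewrite /cut_ok /=; lia.
  + exact: derives0.
set qs := [:: x, y & ps] => pw Pp bx pm.
have [avl avg] := av _ pw Pp.
have uq : uniq (map (f \o fst) qs).
  rewrite uniq_pairwise pairwise_map; apply: sub_pairwise pw => u v /=.
  by rewrite /compat /relpre /=; lia.
have step12 (R : rel nat) : splits R (map (f \o fst) qs) ->
  exists ps1 ps2, [/\ qs = ps1 ++ ps2, ps1 != [::], ps2 != [::] &
    allrel (fun x y => R (f x.1) (f y.1) && compat f g x y) ps1 ps2].
  case=> u [v [E u0 v0 uv]]; exists (take (size u) qs), (drop (size u) qs).
  have E1 : map (f \o fst) (take (size u) qs) = u by rewrite map_take E take_size_cat.
  have E2 : map (f \o fst) (drop (size u) qs) = v by rewrite map_drop E drop_size_cat.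
  split; first by rewrite cat_take_drop.
  - by move: u0; rewrite -E1; case: (take _ _).
  - by move: v0; rewrite -E2; case: (drop _ _).
  move: pw; rewrite -{1}(cat_take_drop (size u) qs) pairwise_cat => /and3P[cc _ _].
  have : allrel R (map (f \o fst) (take (size u) qs)) (map (f \o fst) (drop (size u) qs)).
    by rewrite E1 E2.
  rewrite allrel_mapl allrel_mapr => /allrelP uv'.
  apply/allrelP => s t ss tt; rewrite ((allrelP cc) _ _ ss tt) andbT.
  exact: uv'.
have boxes ps' : all (in_box f g [:: i; j; a; b; i'; j'; a'; b']) ps' ->
   [/\ all (fun x => i <= x.1 < j) ps', all (fun x => a <= f x.1 < b) ps',
       all (fun x => i' <= x.2 < j') ps' & all (fun x => a' <= g x.2 < b') ps'].
  by move=> /allP H; split; apply/allP => z /H /and4P[].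
case: (splits_avoids _ uq avl avg) => // /step12 [ps1 [ps2 [E p10 p20 cc]]];
  rewrite E in pw Pp bx pm *; rewrite /weight big_cat /= -!/(weight _ _) size_cat;
  move: pw; rewrite pairwise_cat => /and3P[_ pw1 pw2];
  move: Pp; rewrite all_cat => /andP[Pp1 Pp2];
  move: bx; rewrite all_cat => /andP[/boxes[bi1 ba1 bi1' ba1'] /boxes[bi2 ba2 bi2' ba2']];
  have [s1 s2] : 0 < size ps1 /\ 0 < size ps2 by [case: (ps1) p10; case: (ps2) p20];
  rewrite size_cat in pm;
  (have [l1 l2 pm1 pm2] : [/\ size ps1 < size ps1 + size ps2, size ps2 < size ps1 + size ps2,
     size ps1 < m & size ps2 < m] by clear -pm s1 s2; split; lia);
  (have xk : allrel (fun x y => x.1 < y.1) ps1 ps2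
    by apply: sub_allrel cc => u v /andP[_ /and3P[]]);
  (have xk' : allrel (fun x y => x.2 < y.2) ps1 ps2
    by apply: sub_allrel cc => u v /andP[_ /and3P[]]);
  have [k [ik kj k1 k2]] := cut_point p10 p20 xk bi1 bi2;
  have [k' [ik' kj' k1' k2']] := cut_point p10 p20 xk' bi1' bi2'.
- have xc : allrel (fun x y => f x.1 < f y.1) ps1 ps2.
    by apply: sub_allrel cc => u v /andP[].
  have xc' : allrel (fun x y => g x.2 < g y.2) ps1 ps2.
    by apply: sub_allrel cc => u v /andP[fuv /compat_lt <-].
  have [c [ac cb c1 c2]] := cut_point p10 p20 xc ba1 ba2.
  have [c' [ac' cb' c1' c2']] := cut_point p10 p20 xc' ba1' ba2'.
  apply: (@derives_sum f g P w _ [:: i; j; a; b; i'; j'; a'; b'; k; c; k'; c']) => //.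
  + by rewrite /cut_ok /= ik kj ac cb ik' kj' ac' cb'.
  + apply: (@derives_leq _ _ _ _ (size ps1).+1) => //.
    apply: IH => //; rewrite /matching pw1 Pp1; apply/allP => z zz.
    by rewrite /= (allP k1) // (allP k1') // (allP c1) // (allP c1').
  + apply: (@derives_leq _ _ _ _ (size ps2).+1) => //.
    apply: IH => //; rewrite /matching pw2 Pp2; apply/allP => z zz.
    by rewrite /= (allP k2) // (allP k2') // (allP c2) // (allP c2').
(* In a skew cut the second part has the smaller values, so the value cuts are found with the parts
   exchanged. *)
- have xc : allrel (fun x y => f x.1 < f y.1) ps2 ps1.
    by rewrite allrelC; apply: sub_allrel cc => u v /andP[].
  have xc' : allrel (fun x y => g x.2 < g y.2) ps2 ps1.
    by rewrite allrelC; apply: sub_allrel cc => u v /andP[fuv /compat_gt <-].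
  have [c [ac cb c1 c2]] := cut_point p20 p10 xc ba2 ba1.
  have [c' [ac' cb' c1' c2']] := cut_point p20 p10 xc' ba2' ba1'.
  apply: (@derives_skew f g P w _ [:: i; j; a; b; i'; j'; a'; b'; k; c; k'; c']) => //.
  + by rewrite /cut_ok /= ik kj ac cb ik' kj' ac' cb'.
  + apply: (@derives_leq _ _ _ _ (size ps1).+1) => //.
    apply: IH => //; rewrite /matching pw1 Pp1; apply/allP => z zz.
    by rewrite /= (allP k1) // (allP k1') // (allP c2) // (allP c2').
  + apply: (@derives_leq _ _ _ _ (size ps2).+1) => //.
    apply: IH => //; rewrite /matching pw2 Pp2; apply/allP => z zz.
    by rewrite /= (allP k2) // (allP k2') // (allP c1) // (allP c1').
Qed.

(** * Common patterns as matchings of positions *)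

(** An increasing list of positions is recovered from its characteristic function, the form in which
    the machine stores it and in which the weights encode it. *)
Lemma ltn_sortedE P n : sorted ltn P -> all (fun p => p < n) P -> P = [seq p <- iota 0 n | p \in P].
Proof.
move=> sP /allP Pn; apply: (irr_sorted_eq ltn_trans ltnn) => //.
  exact: (sorted_filter ltn_trans) (iota_ltn_sorted _ _).
move=> p; rewrite mem_filter mem_iota /= add0n.
by have [/Pn ->|] := boolP (p \in P).
Qed.

Lemma subseq_nth P (s : seq nat) :
  sorted ltn P -> all (fun p => p < size s) P -> subseq (map (nth 0 s) P) s.
Proof.
move=> sP Ps; rewrite (ltn_sortedE sP Ps) -[X in subseq _ X](@mkseq_nth _ 0).
by apply/map_subseq/filter_subseq.
Qed.

Lemma subseq_positions (s t : seq nat) : subseq s t ->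
  exists P, [/\ sorted ltn P, all (fun p => p < size t) P & s = map (nth 0 t) P].
Proof.
case/subseqP => m sm ->; exists (mask m (iota 0 (size t))); split.
- exact: (sorted_mask ltn_trans) (iota_ltn_sorted _ _).
- by apply/allP => p /mem_mask; rewrite mem_iota.
- by rewrite map_mask -/(mkseq _ _) mkseq_nth.
Qed.

Definition standardize (s : seq nat) : seq nat :=
  [seq (count (fun y => y < x) s).+1 | x <- s].

Lemma count_ltn_mono (s : seq nat) x y : x \in s -> y \in s ->
  (count (fun z => z < x) s < count (fun z => z < y) s) = (x < y).
Proof.
have le u v : u <= v -> count (fun z => z < u) s <= count (fun z => z < v) s.
  by move=> uv; apply: sub_count => z /= zu; apply: leq_trans uv.
move=> xs ys; have [xy|yx] := ltnP x y; last by rewrite ltnNge le.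
have -> : count (fun z => z < y) s = count (fun z => z < x) s + count (fun z => x <= z < y) s.
  rewrite -count_predUI -[LHS]addn0; congr (_ + _).
    by apply: eq_count => z /=; lia.
  by rewrite -[LHS](count_pred0 s); apply: eq_count => z /=; lia.
by rewrite -{1}[X in X < _]addn0 ltn_add2l -has_count; apply/hasP; exists x => //; rewrite leqnn.
Qed.

Lemma standardize_iso (s : seq nat) : order_iso (standardize s) s.
Proof.
split; first by rewrite size_map.
rewrite size_map => l m ls ms; rewrite !(nth_map 0) // ltnS.
by rewrite count_ltn_mono ?mem_nth.
Qed.

(** The ranks are distinct and lie between 1 and the length, so by counting they exhaust this
    range. *)
Lemma standardize_perm (s : seq nat) : uniq s -> is_perm (standardize s).
Proof.
move=> us; rewrite /is_perm size_map.
have uS : uniq (standardize s).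
  rewrite map_inj_in_uniq // => x y xs ys [] E.
  have := count_ltn_mono xs ys; have := count_ltn_mono ys xs.
  by rewrite E ltnn; case: ltngtP.
have sub : {subset standardize s <= iota 1 (size s)}.
  move=> _ /mapP[x xs ->]; rewrite mem_iota /= add1n ltnS.
  rewrite ltn_neqAle count_size andbT -all_count; apply/allPn; exists x => //.
  by rewrite ltnn.
apply: uniq_perm (iota_uniq _ _) _ => //.
by have [|//] := uniq_min_size uS sub; rewrite size_iota size_map.
Qed.

Lemma is_perm_uniq s : is_perm s -> uniq s.
Proof. by move/perm_uniq->; apply: iota_uniq. Qed.

Lemma is_perm_nth s p : is_perm s -> p < size s -> 0 < nth 0 s p <= size s.
Proof.
move=> /perm_mem H ps; have := H (nth 0 s p).
by rewrite mem_nth // mem_iota add1n ltnS.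
Qed.

Lemma order_iso_sym s t : order_iso s t -> order_iso t s.
Proof. by case=> E H; split=> // l m; rewrite -E => *; rewrite H. Qed.

Lemma order_iso_trans s t r : order_iso s t -> order_iso t r -> order_iso s r.
Proof.
case=> E H [E' H']; split=> [|l m ls ms]; first by rewrite E.
by rewrite H // H' // -E.
Qed.

(* As [g] will be [nth 0 tau] for a permutation [tau], the condition [g x.2 != 0] means that [x.2] is
   a position of [tau]; it can be tested without knowing the length of [tau]. *)
Definition valid_pair (n : nat) (g : nat -> nat) (x : nat * nat) : bool :=
  (x.1 < n) && (g x.2 != 0).

Lemma compat_fst f g ps : pairwise (compat f g) ps -> sorted ltn (map fst ps).
Proof.
move=> H; rewrite sorted_pairwise; last exact: ltn_trans.
by rewrite pairwise_map; apply: sub_pairwise H => x y /and3P[].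
Qed.

Lemma compat_snd f g ps : pairwise (compat f g) ps -> sorted ltn (map snd ps).
Proof.
move=> H; rewrite sorted_pairwise; last exact: ltn_trans.
by rewrite pairwise_map; apply: sub_pairwise H => x y /and3P[].
Qed.

Lemma separable_avoids sigma : separable sigma -> avoids ltn sigma /\ avoids gtn sigma.
Proof.
case=> S1 S2; split=> a b c d sub bd da ac; [apply: S1|apply: S2];
  exists [:: a; b; c; d] => //; split=> // -[|[|[|[|]]]] //= [|[|[|[|]]]] //= _ _; 
  move: bd da ac => /=; lia.
Qed.

Lemma separable_avoids_compat sigma g (P : pred (nat * nat)) ps : separable sigma ->
  (forall x, P x -> x.1 < size sigma) ->
  pairwise (compat (nth 0 sigma) g) ps -> all P ps ->
  avoids ltn (map (nth 0 sigma \o fst) ps) /\ avoids gtn (map (nth 0 sigma \o fst) ps).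
Proof.
move=> /separable_avoids[S1 S2] Pn pw Pp; rewrite map_comp.
suff sub : subseq (map (nth 0 sigma) (map fst ps)) sigma by split; apply: avoids_sub sub _.
apply: subseq_nth; first exact: compat_fst pw.
by rewrite all_map; apply: sub_all Pp => x /Pn.
Qed.

Definition full_box (N : nat) : seq nat := [:: 0; N; 0; N; 0; N; 0; N].

(** The two occurrences of [rho] are increasing lists of positions of equal length; zipped together
    they are the matching. *)
Lemma pattern_matching sigma tau rho N : is_perm sigma -> is_perm tau ->
  size sigma + size tau < N ->
  is_perm rho -> is_pattern rho sigma -> is_pattern rho tau ->
  exists2 ps, matching (nth 0 sigma) (nth 0 tau) (valid_pair (size sigma) (nth 0 tau)) (full_box N) ps
    & size ps = size rho.
Proof.
move=> ps pt N0 pr [s /subseq_positions[P [sP Pn ->]] iP] [t /subseq_positions[Q [sQ Qn ->]] iQ].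
have sz : size P = size Q by case: iP => + _; case: iQ => + _; rewrite !size_map => -> ->.
have rP : size rho = size P by case: iP => + _; rewrite size_map.
exists (zip P Q); last by rewrite size_zip -sz minnn.
have Pnth i : i < size P -> nth 0 P i < size sigma by move=> ?; apply: (allP Pn); apply: mem_nth.
have Qnth i : i < size P -> nth 0 Q i < size tau.
  by move=> ?; apply: (allP Qn); apply: mem_nth; rewrite -sz.
rewrite /matching; apply/and3P; split.
- apply/(pairwiseP (0, 0)) => i j; rewrite !inE size_zip -sz minnn => iP' jP' ij.
  rewrite !nth_zip // /compat /=.
  have lP : nth 0 P i < nth 0 P j.
    by move/(sorted_ltn_nth ltn_trans 0): sP; apply.
  have lQ : nth 0 Q i < nth 0 Q j.
    by move/(sorted_ltn_nth ltn_trans 0): sQ; apply; rewrite ?inE -?sz.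
  rewrite lP lQ /=.
  have nth_eq r R k : k < size R -> nth 0 (map (nth 0 r) R) k = nth 0 r (nth 0 R k) by move=> ?; rewrite (nth_map 0).
  have H (l l' : nat) : l < size P -> l' < size P ->
      (nth 0 sigma (nth 0 P l) < nth 0 sigma (nth 0 P l')) =
      (nth 0 tau (nth 0 Q l) < nth 0 tau (nth 0 Q l')).
    move=> lP' lP''; have [_ /(_ l l')] := order_iso_trans (order_iso_sym iP) iQ.
    by rewrite size_map !nth_eq -?sz //; apply.
  have Hij := H _ _ iP' jP'; have Hji := H _ _ jP' iP'.
  rewrite -Hij -Hji !andbb -neq_ltn nth_uniq ?is_perm_uniq ?Pnth //.
  by move: lP; rewrite ltn_neqAle => /andP[].
- apply/(all_nthP (0, 0)) => i; rewrite size_zip -sz minnn => iP'.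
  rewrite nth_zip // /valid_pair /= Pnth //= -lt0n.
  by case/andP: (is_perm_nth pt (Qnth _ iP')).
- apply/(all_nthP (0, 0)) => i; rewrite size_zip -sz minnn => iP'.
  rewrite nth_zip // /in_box /=.
  have := Pnth _ iP'; have := Qnth _ iP'.
  have := is_perm_nth pt (Qnth _ iP'); have := is_perm_nth ps (Pnth _ iP').
  by clear -N0; lia.
Qed.

(** By [pattern_matching] every common pattern comes from a matching of its length, so a longest
    matching yields a longest pattern. *)
Lemma matching_LCP sigma tau ps0 N : is_perm sigma -> is_perm tau ->
  size sigma + size tau < N ->
  matching (nth 0 sigma) (nth 0 tau) (valid_pair (size sigma) (nth 0 tau)) (full_box N) ps0 ->
  (forall ps, matching (nth 0 sigma) (nth 0 tau) (valid_pair (size sigma) (nth 0 tau)) (full_box N) ps ->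
     size ps <= size ps0) ->
  is_LCP (standardize (map (nth 0 sigma) (map fst ps0))) sigma tau.
Proof.
move=> ps pt N0 /and3P[pw Pp _] mx.
have Pn : all (fun p => p < size sigma) (map fst ps0).
  by rewrite all_map; apply: sub_all Pp => x /andP[].
have Qn : all (fun q => q < size tau) (map snd ps0).
  by rewrite all_map; apply: sub_all Pp => x /= /andP[_]; apply: contraNltn => ?; rewrite nth_default.
have sP := compat_fst pw; have sQ := compat_snd pw.
have uP : uniq (map (nth 0 sigma) (map fst ps0)).
  by apply: subseq_uniq (is_perm_uniq ps); apply: subseq_nth.
split.
- exact: standardize_perm.
- exists (map (nth 0 sigma) (map fst ps0)); first exact: subseq_nth.
  exact: standardize_iso.
- exists (map (nth 0 tau) (map snd ps0)); first exact: subseq_nth.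
  apply: order_iso_trans (standardize_iso _) _; split; first by rewrite !size_map.
  rewrite !size_map => l m ls ms; rewrite !(nth_map 0) ?size_map // !(nth_map (0, 0)) //.
  move/(pairwiseP (0, 0)): pw => cc.
  case: (ltngtP l m) => [lm|ml|->].
  + by apply: compat_lt; apply: cc.
  + by apply: compat_gt; apply: cc.
  + by rewrite !ltnn.
- move=> rho pr r1 r2; have [qs /mx + <-] := pattern_matching ps pt N0 pr r1 r2.
  by rewrite !size_map.
Qed.

(** * A loop language and its compilation *)

(* [Get] and [Put] access the [k]-th of four interleaved arrays, [Peek] and [Poke] the flat memory
   above the registers.  Register 0 holds [size sigma] and register 1 the offset [Z] of the arrays;
   they are read-only and are the only loop bounds, which makes the running time a function of the
   syntax. *)
Inductive cmd :=
| Const (r c : nat)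
| Add (r a b : nat)
| Sub (r a b : nat)
| Get (k r a : nat)
| Put (k a b : nat)
| Peek (r a : nat)
| Poke (a b : nat)
| Seq (c1 c2 : cmd)
| When (r : nat) (c : cmd)
| For (x l : nat) (c : cmd).

Notation "c1 ;; c2" := (Seq c1 c2) (at level 60, right associativity).

Definition nregs := 32.

Record state := State { reg : nat -> nat; heap : nat -> nat }.

Definition set_reg (s : state) (r v : nat) : state := State (upd (reg s) r v) (heap s).
Definition set_heap (s : state) (a v : nat) : state := State (reg s) (upd (heap s) a v).

(** Interleaving yields four unbounded arrays whose lengths need not be known, with addresses
    computed by additions alone. *)
Definition cell (Z k i : nat) : nat := Z + 4 * i + k.

Fixpoint exec (c : cmd) (s : state) : state :=
  match c with
  | Const r v => set_reg s r v
  | Add r a b => set_reg s r (reg s a + reg s b)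
  | Sub r a b => set_reg s r (reg s a - reg s b)
  | Get k r a => set_reg s r (heap s (cell (reg s 1) k (reg s a)))
  | Put k a b => set_heap s (cell (reg s 1) k (reg s a)) (reg s b)
  | Peek r a => set_reg s r (heap s (nregs + reg s a))
  | Poke a b => set_heap s (nregs + reg s a) (reg s b)
  | Seq c1 c2 => exec c2 (exec c1 s)
  | When r c => if reg s r == 0 then s else exec c s
  | For x l c =>
      set_reg (iteri (reg s l) (fun i s => exec c (set_reg s x i)) s) x (reg s l)
  end.

Fixpoint written (c : cmd) : seq nat :=
  match c with
  | Const r _ | Add r _ _ | Sub r _ _ | Get _ r _ | Peek r _ => [:: r]
  | Put _ _ _ | Poke _ _ => [::]
  | Seq c1 c2 => written c1 ++ written c2
  | When _ c => written c
  | For x _ c => x :: written c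
  end.

Definition readable (r : nat) : bool := r < nregs - 2.
Definition writable (r : nat) : bool := 1 < r < nregs - 2.

Fixpoint well_formed (c : cmd) : bool :=
  match c with
  | Const r _ => writable r
  | Add r a b | Sub r a b => [&& writable r, readable a & readable b]
  | Get _ r a | Peek r a => writable r && readable a
  | Put _ a b | Poke a b => readable a && readable b
  | Seq c1 c2 => well_formed c1 && well_formed c2
  | When r c => readable r && well_formed c
  | For x l c => [&& writable x, l < 2, x \notin written c & well_formed c]
  end.

(** A time bound when registers 0 and 1 are at most [N]. A pass of a loop adds two instructions for
    the test and three to increment and jump back; the constant 3 pays for the initialisation and
    the last test. *)
Fixpoint steps (N : nat) (c : cmd) : nat :=
  match c with
  | Const _ _ | Add _ _ _ | Sub _ _ _ => 1
  | Get _ _ _ | Put _ _ _ => 6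
  | Peek _ _ | Poke _ _ => 3
  | Seq c1 c2 => steps N c1 + steps N c2
  | When _ c => (steps N c).+1
  | For _ _ c => 3 + N * (steps N c + 5)
  end.

(* Registers 30 and 31 are reserved for compiled code. *)
Definition addr_code (k a : nat) : program :=
  [:: IConst 31 k; IAdd 30 a a; IAdd 30 30 30; IAdd 30 30 1; IAdd 30 30 31].

Fixpoint code (c : cmd) (o : nat) : program :=
  match c with
  | Const r v => [:: IConst r v]
  | Add r a b => [:: IAdd r a b]
  | Sub r a b => [:: ISub r a b]
  | Get k r a => addr_code k a ++ [:: ILoad r 30]
  | Put k a b => addr_code k a ++ [:: IStore 30 b]
  | Peek r a => [:: IConst 30 nregs; IAdd 30 30 a; ILoad r 30]
  | Poke a b => [:: IConst 30 nregs; IAdd 30 30 a; IStore 30 b]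
  | Seq c1 c2 => let p := code c1 o in p ++ code c2 (o + size p)
  | When r c => let p := code c o.+1 in IJz r (o.+1 + size p) :: p
  | For x l c =>
      let p := code c (o + 3) in
      [:: IConst x 0; ISub 30 l x; IJz 30 (o + (size p + 6))] ++ p ++
      [:: IConst 30 1; IAdd x x 30; IJmp o.+1]
  end.

(** * Correctness and cost of the compiled code *)

Lemma exec_frame c s r : r \notin written c -> reg (exec c s) r = reg s r.
Proof.
elim: c s => //= [q v|q a b|q a b|k q a|q a|c1 IH1 c2 IH2|q c IH|x l c IH] s;
  rewrite ?inE /upd ?mem_cat ?negb_or; try by move/negbTE->.
- by case/andP=> r1 r2; rewrite IH2 // IH1.
- by case: eqP => // _ /IH.
- case/andP=> /negbTE rx rc; rewrite rx; elim: (reg s l) => //= n <-.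
  by rewrite IH //= /upd rx.
Qed.

Lemma well_formed_frame c s r : well_formed c -> r < 2 -> reg (exec c s) r = reg s r.
Proof.
move=> wf r2; apply: exec_frame; elim: c wf => //= [q v|q a b|q a b|k q a|q a|c1 IH1 c2 IH2|q c IH|x l c IH];
  rewrite ?inE /writable ?mem_cat; try lia.
- by case/andP=> w1 w2; rewrite negb_or IH1 ?IH2.
- by case/and4P=> wx _ _ w; rewrite negb_or IH // andbT; lia.
Qed.

Definition embeds (p : program) (o : nat) (q : program) : Prop :=
  forall i, i < size q -> nth IHalt p (o + i) = nth IHalt q i.

Lemma embeds_cat p o q1 q2 :
  embeds p o (q1 ++ q2) -> embeds p o q1 /\ embeds p (o + size q1) q2.
Proof.
move=> H; split=> i iq.
- by rewrite H ?nth_cat ?iq // size_cat ltn_addr.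
- rewrite -addnA H ?nth_cat ?size_cat ?ltn_add2l //.
  by rewrite ltnNge leq_addr /= addKn.
Qed.

Lemma embeds_cons p o i q : embeds p o (i :: q) -> nth IHalt p o = i /\ embeds p o.+1 q.
Proof.
move=> H; split; first by have := H 0; rewrite addn0; apply.
by move=> j jq; rewrite addSnnS H.
Qed.

Definition straight_line (i : instr) : bool :=
  match i with IJz _ _ | IJmp _ | IHalt => false | _ => true end.

Definition effect (m : nat -> nat) (i : instr) : nat -> nat :=
  Defs.mem (step [:: i] (Config 0 m)).

Definition reaches (p : program) (N : nat) (c : config) (Q : config -> Prop) : Prop :=
  exists2 t, t <= N & Q (iter t (step p) c).

Lemma reaches_trans p N1 N2 c (Q1 Q2 : config -> Prop) : reaches p N1 c Q1 ->
  (forall c', Q1 c' -> reaches p N2 c' Q2) -> reaches p (N1 + N2) c Q2.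
Proof.
case=> t1 tN1 Q1c /(_ _ Q1c)[t2 tN2 Q2c]; exists (t2 + t1); last by rewrite iterD.
by rewrite addnC leq_add.
Qed.

Lemma reaches0 p N c (Q : config -> Prop) : Q c -> reaches p N c Q.
Proof. by exists 0. Qed.

Lemma reaches_step p N c (Q : config -> Prop) :
  reaches p N (step p c) Q -> reaches p N.+1 c Q.
Proof. by case=> t tN Qt; exists t.+1 => //; rewrite iterSr. Qed.

Lemma reaches_leq p N N' c (Q : config -> Prop) :
  N <= N' -> reaches p N c Q -> reaches p N' c Q.
Proof. by move=> NN' [t tN Qt]; exists t => //; apply: leq_trans NN'. Qed.

Lemma reaches_straight p o q m (Q : config -> Prop) : embeds p o q -> all straight_line q ->
  Q (Config (o + size q) (foldl effect m q)) -> reaches p (size q) (Config o m) Q.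
Proof.
elim: q o m => [|i q IH] o m /=; first by rewrite addn0 => *; apply: reaches0.
case/embeds_cons=> pi pq /andP[si sq] Qc; apply: reaches_step.
suff -> : step p (Config o m) = Config o.+1 (effect m i) by apply: IH => //; rewrite addSnnS.
by rewrite /step /= pi /effect /=; case: (i) si.
Qed.

(** The scratch registers 30 and 31 are left unconstrained, so address computations do not disturb
    the relation. *)
Definition simulates (s : state) (m : nat -> nat) : Prop :=
  (forall r, readable r -> m r = reg s r) /\ (forall a, nregs <= a -> m a = heap s a).

Lemma simulates_reg s m r v : readable r -> simulates s m -> simulates (set_reg s r v) (upd m r v).
Proof.
move=> rr [H1 H2]; split=> a ra; rewrite /= /upd; first by case: eqP => // _; apply: H1.
by case: eqP => [E|_]; [move: rr ra; rewrite /readable /nregs E; lia | apply: H2].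
Qed.

Lemma simulates_heap s m a v :
  nregs <= a -> simulates s m -> simulates (set_heap s a v) (upd m a v).
Proof.
move=> aa [H1 H2]; split=> b bb; rewrite /= /upd; last by case: eqP => // _; apply: H2.
by case: eqP => [E|_]; [move: aa bb; rewrite /readable /nregs E; lia | apply: H1].
Qed.

Lemma simulates_hidden s m r v :
  nregs - 2 <= r < nregs -> simulates s m -> simulates s (upd m r v).
Proof.
by move=> rr [H1 H2]; split=> b; rewrite /upd => bb; case: eqP bb => [->|_]; auto;
  move: rr; rewrite /readable /nregs; lia.
Qed.

Lemma writable_readable r : writable r -> readable r.
Proof. by case/andP. Qed.

(** The bound [nregs <= reg s 1] puts the arrays above the registers, so a [Put] never hits a
    register. *)
Lemma code_correct c N p : well_formed c -> forall o s m,
  nregs <= reg s 1 -> reg s 0 <= N -> reg s 1 <= N ->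
  embeds p o (code c o) -> simulates s m ->
  reaches p (steps N c) (Config o m)
    (fun cfg => pc cfg = o + size (code c o) /\ simulates (exec c s) (Defs.mem cfg)).
Proof.
have addr k a q (s : state) m : readable a -> nregs <= reg s 1 -> simulates s m ->
    exists m', [/\ foldl effect m (addr_code k a ++ q) = foldl effect m' q,
      m' 30 = cell (reg s 1) k (reg s a) & simulates s m'].
  move=> ra s1 sm; rewrite foldl_cat; eexists; split; first by [].
    rewrite /= /effect /= /upd /=.
    have r1 := sm.1 1 isT; have rra := sm.1 a ra.
    have [] : a != 31 /\ 1 != 30 by move: ra; rewrite /readable /nregs; lia.
    move=> /negbTE ->; rewrite /cell r1 rra; lia.
  by do 5 apply: simulates_hidden => //.
elim: c => [r v|r a b|r a b|k r a|k a b|r a|a b|c1 IH1 c2 IH2|r c IH|x l c IH] /= wf o s m sZ s0 s1 em sm.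
- apply: reaches_straight em _ _ => //=; split=> //; apply: simulates_reg => //.
  exact: writable_readable.
- case/and3P: wf => /writable_readable wr ra rb.
  apply: reaches_straight em _ _ => //=; split=> //; rewrite /effect /= -!(sm.1) //.
  exact: simulates_reg.
- case/and3P: wf => /writable_readable wr ra rb.
  apply: reaches_straight em _ _ => //=; split=> //; rewrite /effect /= -!(sm.1) //.
  exact: simulates_reg.
- case/andP: wf => /writable_readable wr ra.
  apply: reaches_straight em _ _ => //; split=> //; rewrite /Defs.mem.
  have [m' [-> m30 sm']] := addr k a [:: ILoad r 30] s m ra sZ sm.
  rewrite /effect /= m30 (sm'.2); first exact: simulates_reg.
  by apply: leq_trans sZ _; rewrite /cell -addnA leq_addr.
- case/andP: wf => ra rb.
  apply: reaches_straight em _ _ => //; split=> //; rewrite /Defs.mem.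
  have [m' [-> m30 sm']] := addr k a [:: IStore 30 b] s m ra sZ sm.
  rewrite /effect /= m30 (sm'.1) // ; apply: simulates_heap => //.
  by apply: leq_trans sZ _; rewrite /cell -addnA leq_addr.
- case/andP: wf => /writable_readable wr ra.
  apply: reaches_straight em _ _ => //; split=> //; rewrite /Defs.mem.
  rewrite -[foldl _ _ _]/(effect (foldl effect m [:: IConst 30 nregs; IAdd 30 30 a]) (ILoad r 30)).
  set m' := foldl _ _ _.
  have [m30 sm'] : m' 30 = nregs + reg s a /\ simulates s m'.
    split; first by rewrite /m' /= /effect /= /upd /= ifN ?sm.1 //; move: ra; rewrite /readable /nregs; lia.
    by do 2 apply: simulates_hidden => //.
  by rewrite /effect /= m30 (sm'.2) ?leq_addr //; apply: simulates_reg.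
- case/andP: wf => ra rb.
  apply: reaches_straight em _ _ => //; split=> //; rewrite /Defs.mem.
  rewrite -[foldl _ _ _]/(effect (foldl effect m [:: IConst 30 nregs; IAdd 30 30 a]) (IStore 30 b)).
  set m' := foldl _ _ _.
  have [m30 sm'] : m' 30 = nregs + reg s a /\ simulates s m'.
    split; first by rewrite /m' /= /effect /= /upd /= ifN ?sm.1 //; move: ra; rewrite /readable /nregs; lia.
    by do 2 apply: simulates_hidden => //.
  by rewrite /effect /= m30 (sm'.1) //; apply: simulates_heap; rewrite ?leq_addr.
- case/andP: wf => wf1 wf2; case/embeds_cat: em => em1 em2.
  apply: reaches_trans; first exact: (IH1 wf1 _ _ _ sZ s0 s1 em1 sm).
  case=> _ m' /= [-> sm'].
  by rewrite size_cat addnA; apply: IH2; rewrite // well_formed_frame.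
- case/andP: wf => rr wf; case/embeds_cons: em => jz em.
  apply: reaches_step; rewrite /step /= jz (sm.1) //.
  case: eqP => _; first by apply: reaches0; rewrite addnS addSn.
  by rewrite addnS -addSn; apply: IH.
case/and4P: wf => wx l2 xc wf.
have rx := writable_readable wx.
have rl : readable l by move: l2; rewrite /readable /nregs; lia.
have xl : (l == x) = false by move: wx l2; rewrite /writable; lia.
set F := fun i s => exec c (set_reg s x i).
set L := reg s l.
case/embeds_cons: em => i0 /embeds_cons[i1] /embeds_cons[i2] /embeds_cat[].
set q := code c (o + 3) => em3.
have -> : o.+3 + size q = (o + size q).+3 by lia.
case/embeds_cons => i4 /embeds_cons[i5] /embeds_cons[i6 _].
have frame i r : r < 2 -> reg (iteri i F s) r = reg s r.
  move=> r2; elim: i => //= i <-; rewrite /F well_formed_frame //= /upd ifN //.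
  by move: wx r2; rewrite /writable; lia.
(* Induction on the number [d] of passes still to be made, starting from the loop test. *)
have head d : forall i m, i + d = L -> simulates (set_reg (iteri i F s) x i) m ->
    reaches p (2 + d * (steps N c + 5)) (Config o.+1 m)
      (fun cfg => pc cfg = o + (size q + 6) /\ simulates (set_reg (iteri L F s) x L) (Defs.mem cfg)).
  elim: d => [|d IHd] i m' iL sm'.
    rewrite addn0 in iL; rewrite mul0n; do 2 (apply: reaches_step; rewrite /step /= ?i1 ?i2).
    rewrite /upd /= (sm'.1 l) // (sm'.1 x) //= /upd xl eqxx frame // iL subnn.
    by apply: reaches0; split=> //; rewrite -iL; apply: simulates_hidden.
  have -> : 2 + d.+1 * (steps N c + 5) = (steps N c + (3 + (2 + d * (steps N c + 5)))).+2.
    by rewrite mulSn; lia.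
  do 2 (apply: reaches_step; rewrite /step /= ?i1 ?i2).
  rewrite {1 2}/upd /= (sm'.1 l) // (sm'.1 x) //= /upd xl eqxx frame //.
  have /negbTE -> : reg s l - i != 0 by rewrite -/L; lia.
  apply: reaches_trans.
    apply: (IH wf o.+3 (set_reg (iteri i F s) x i)) => /=.
    - rewrite /upd ifN ?frame //; move: wx; rewrite /writable; lia.
    - rewrite /upd ifN ?frame //; move: wx; rewrite /writable; lia.
    - rewrite /upd ifN ?frame //; move: wx; rewrite /writable; lia.
    - by move: em3; rewrite /q addn3.
    - exact: simulates_hidden.
  case=> _ m3 /= [-> sm3].
  have -> : o.+3 + size (code c o.+3) = (o + size q).+3 by rewrite /q addn3; lia.
  do 3 (apply: reaches_step; rewrite /step /= ?i4 ?i5 ?i6).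
  apply: (IHd i.+1); first by rewrite addSn -addnS.
  have x30 : x != 30 by move: rx; rewrite /readable /nregs; lia.
  have mx : m3 x = i by rewrite (sm3.1 x) // exec_frame //= /upd eqxx.
  rewrite {2 3}/upd (negbTE x30) /= mx addn1.
  have sm4 : simulates (iteri i.+1 F s) (upd m3 30 1) by apply: simulates_hidden.
  exact: (simulates_reg i.+1 rx sm4).
rewrite size_cat /= -/q; have -> : (size q + 3).+3 = size q + 6 by lia.
have -> : 3 + N * (steps N c + 5) = (2 + N * (steps N c + 5)).+1 by lia.
apply: reaches_step; rewrite /step /= i0.
have LN : L <= N by rewrite /L; case: (l) l2 => [|[|]].
apply: (@reaches_leq _ (2 + L * (steps N c + 5))); first by rewrite leq_add2l leq_mul2r LN orbT.
by apply: (head L 0) => //; apply: simulates_reg.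
Qed.

(** Each [For] raises the exponent by one; in a sequence the exponents are simply added. *)
Lemma steps_poly c : exists C k, forall N, steps N c <= C * N.+1 ^ k.
Proof.
have const n (f : nat -> nat) : (forall N, f N = n) -> exists C k, forall N, f N <= C * N.+1 ^ k.
  by move=> fn; exists n, 0 => N; rewrite fn expn0 muln1.
elim: c => /= [r v|r a b|r a b|k r a|k a b|r a|a b|c1 [C1 [k1 H1]] c2 [C2 [k2 H2]]|r c [C [k H]]|x l c [C [k H]]].
1-7: exact: const.
- exists (C1 + C2), (k1 + k2) => N; rewrite mulnDl; apply: leq_add.
    by apply: leq_trans (H1 N) _; rewrite leq_mul2l leq_pexp2l ?leq_addr ?orbT.
  by apply: leq_trans (H2 N) _; rewrite leq_mul2l leq_pexp2l ?leq_addl ?orbT.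
- exists C.+1, k => N; rewrite mulSn -addn1 addnC.
  by rewrite leq_add ?expn_gt0.
- exists (3 + (C + 5)), k.+1 => N; rewrite mulnDl; apply: leq_add.
    by rewrite leq_pmulr ?expn_gt0.
  rewrite expnS mulnCA; apply: leq_mul => //.
  by rewrite mulnDl leq_add // leq_pmulr ?expn_gt0.
Qed.

Fixpoint storeless (c : cmd) : bool :=
  match c with
  | Put _ _ _ | Poke _ _ => false
  | Seq c1 c2 => storeless c1 && storeless c2
  | When _ c | For _ _ c => storeless c
  | _ => true
  end.

Lemma exec_storeless c s : storeless c -> heap (exec c s) = heap s.
Proof.
elim: c s => //= [c1 IH1 c2 IH2|r c IH|x l c IH] s.
- by case/andP=> st1 st2; rewrite IH2 // IH1.
- by case: eqP => // _ /IH.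
- by move=> st; elim: (reg s l) => //= n IHn; rewrite IH.
Qed.

(** The invariant must survive assignments to the loop variable, which [For] sets before each pass
    and once more at the end. *)
Lemma for_ind (I : nat -> state -> Prop) x l c s :
  (forall i s v, I i s -> I i (set_reg s x v)) -> I 0 s ->
  (forall i s', i < reg s l -> reg s' x = i -> I i s' -> I i.+1 (exec c s')) ->
  I (reg s l) (exec (For x l c) s).
Proof.
move=> Ix I0 IS /=.
have H n : n <= reg s l -> I n (iteri n (fun i s => exec c (set_reg s x i)) s).
  elim: n => //= n IHn ns; apply: IS => //; first by rewrite /= /upd eqxx.
  exact/Ix/IHn/ltnW.
exact/Ix/H.
Qed.

Fixpoint nest (xs : seq nat) (c : cmd) : cmd :=
  if xs is x :: xs' then For x 1 (nest xs' c) else c.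

Lemma written_nest xs c : written (nest xs c) = xs ++ written c.
Proof. by elim: xs => //= x xs ->. Qed.

(** The body establishes [G] for the current tuple of loop variables and preserves it for all
    others, so at the end [G] holds for every tuple with entries below [Z]. *)
Lemma nest_ind n Z zs c (Inv : (nat -> nat) -> Prop) (G : seq nat -> (nat -> nat) -> Prop) :
  uniq zs -> all (fun x => (1 < x) && (x \notin written c)) zs ->
  0 \notin written c -> 1 \notin written c ->
  (forall s, reg s 0 = n -> reg s 1 = Z -> all (fun v => v < Z) (map (reg s) zs) -> Inv (heap s) ->
     [/\ Inv (heap (exec c s)), forall vs, G vs (heap s) -> G vs (heap (exec c s)) &
         G (map (reg s) zs) (heap (exec c s))]) ->
  forall s, reg s 0 = n -> reg s 1 = Z -> Inv (heap s) ->
    Inv (heap (exec (nest zs c) s)) /\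
    forall vs, size vs = size zs -> all (fun v => v < Z) vs -> G vs (heap (exec (nest zs c) s)).
Proof.
move=> uz az w0 w1 body.
(* Generalised to the inner loops [xs], run while the outer variables [ys] have the fixed values
   [us]. *)
suff gen xs : forall ys us s, zs = ys ++ xs -> reg s 0 = n -> reg s 1 = Z -> Inv (heap s) ->
    map (reg s) ys = us -> all (fun v => v < Z) us ->
    [/\ Inv (heap (exec (nest xs c) s)),
        forall vs, G vs (heap s) -> G vs (heap (exec (nest xs c) s)) &
        forall vs, size vs = size xs -> all (fun v => v < Z) vs ->
          G (us ++ vs) (heap (exec (nest xs c) s))].
  move=> s s0 s1 Is; have [] := gen zs [::] [::] s erefl s0 s1 Is erefl isT; split=> //.
elim: xs => [|x xs IH] ys us s zE s0 s1 Is usE usZ.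
  rewrite cats0 in zE; subst ys; rewrite -usE in usZ; have [? ? Gz] := body s s0 s1 usZ Is.
  by split=> // -[] // _ _; rewrite cats0 -usE.
have xz : x \in zs by rewrite zE mem_cat inE eqxx orbT.
have [x1 xc] : 1 < x /\ x \notin written c by apply/andP; apply: (allP az).
have notin y : y \in rcons ys x -> y \notin written (nest xs c).
  move=> yx; rewrite written_nest mem_cat negb_or.
  have yz : y \in zs by rewrite zE -cat_rcons mem_cat yx.
  case/andP: (allP az _ yz) => _ ->; rewrite andbT.
  by move: uz; rewrite zE -cat_rcons cat_uniq => /and3P[_ /hasPn H _]; apply: contraL (yx) => /H.
have notin01 y : y < 2 -> y \notin written (nest xs c).
  move=> y2; rewrite written_nest mem_cat negb_or; apply/andP; split; last by case: y y2 => [|[|]].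
  apply/negP => yx; have yz : y \in zs by rewrite zE mem_cat inE yx !orbT.
  by case/andP: (allP az _ yz) => + _; rewrite ltnNge -ltnS y2.
have yx y : y \in ys -> y == x = false.
  move=> yy; apply/negP => /eqP E; move: uz; rewrite zE -E cat_uniq /= => /and3P[_ /norP[/negP]].
  by rewrite yy.
pose I i s' := [/\ reg s' 0 = n, reg s' 1 = Z, map (reg s') ys = us, Inv (heap s') &
   (forall vs, G vs (heap s) -> G vs (heap s')) /\
   (forall v vs, v < i -> size vs = size xs -> all (fun v => v < Z) vs -> G (us ++ v :: vs) (heap s'))].
suff [] : I (reg s 1) (exec (For x 1 (nest xs c)) s).
  move=> _ _ _ ? [? GI]; split=> // -[|v vs] //= [sv] /andP[vZ av]; apply: GI => //.
  by rewrite s1.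
apply: for_ind.
- move=> i s' v [e0 e1 eu Ie GI]; split=> //.
  + by rewrite /= /upd; case: eqP x1 => [<-|].
  + by rewrite /= /upd; case: eqP x1 => [<-|].
  + by rewrite -eu; apply/eq_in_map => y /yx; rewrite /= /upd => ->.
- by split=> //; split.
- rewrite s1 => i s' iZ s'x [e0 e1 eu Ie [Gm GI]].
  have zE' : zs = rcons ys x ++ xs by rewrite cat_rcons.
  have eu' : map (reg s') (rcons ys x) = rcons us i by rewrite map_rcons eu s'x.
  have uZ' : all (fun v => v < Z) (rcons us i) by rewrite all_rcons iZ.
  have [I' Gm' GI'] := IH _ _ s' zE' e0 e1 Ie eu' uZ'.
  split=> //.
  + by rewrite exec_frame ?notin01.
  + by rewrite exec_frame ?notin01.
  + rewrite -eu; apply/eq_in_map => y yy; rewrite exec_frame ?notin //.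
    by rewrite mem_rcons inE yy orbT.
  + split=> [vs /Gm/Gm'//|v vs]; rewrite ltnS leq_eqVlt => /orP[/eqP->|vi] sv av.
      by rewrite -cat_rcons; apply: GI'.
    by apply: Gm'; apply: GI.
Qed.

(** * The program *)

(** The numeral in base [Z] with digits [vs]; digits below [Z] give distinct boxes distinct
    cells. *)
Definition index_of (Z : nat) (vs : seq nat) : nat := foldl (fun t v => t * Z + v) 0 vs.

Lemma index_of_inj Z us vs : size us = size vs -> all (fun v => v < Z) us ->
  all (fun v => v < Z) vs -> index_of Z us = index_of Z vs -> us = vs.
Proof.
elim/last_ind: us vs => [|us u IH] vs; first by move/esym/size0nil.
case/lastP: vs => [|vs v]; first by rewrite size_rcons.
rewrite !size_rcons !all_rcons /index_of !foldl_rcons -!/(index_of _ _).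
move=> [sz] /andP[uZ au] /andP[vZ av] E.
have Z0 : 0 < Z by apply: leq_trans uZ.
have uv : u = v by have := congr1 (modn^~ Z) E; rewrite !modnMDl !modn_small.
rewrite uv (IH vs) //; move/eqP: E; rewrite uv eqn_add2r eqn_pmul2r //.
by move/eqP.
Qed.

Lemma cell_inj Z k k' i i' : k < 4 -> k' < 4 -> cell Z k i = cell Z k' i' -> k = k' /\ i = i'.
Proof. by rewrite /cell; lia. Qed.

(** Horner's rule for [index_of]; the product by [Z] is a loop of [Z] additions. *)
Definition address (d : nat) (rs : seq nat) : cmd :=
  foldl (fun c r => c ;; Const 18 0 ;; For 17 1 (Add 18 18 d) ;; Add d 18 r) (Const d 0) rs.

Lemma written_address d rs : {subset written (address d rs) <= [:: d; 17; 18]}.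
Proof.
elim/last_ind: rs => [|rs r IH] x; rewrite /address ?foldl_rcons; first by rewrite !inE => ->.
rewrite mem_cat => /orP[/IH //|]; rewrite /= !inE.
by case/or4P=> ->; rewrite ?orbT.
Qed.

Lemma storeless_address d rs : storeless (address d rs).
Proof. by elim/last_ind: rs => // rs r IH; rewrite /address foldl_rcons /= IH. Qed.

Lemma exec_address d rs s : d \notin [:: 1; 17; 18] ->
  all (fun r => r \notin [:: d; 17; 18]) rs ->
  reg (exec (address d rs) s) d = index_of (reg s 1) (map (reg s) rs).
Proof.
rewrite !inE !negb_or => /and3P[d1 d17 d18].
elim/last_ind: rs => [|rs r IH]; first by rewrite /= /upd eqxx.
rewrite all_rcons => /andP[rd ard].
rewrite map_rcons /index_of /address !foldl_rcons -/(address _ _) -/(index_of _ _).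
set s1 := exec (address d rs) s.
have fr x : x \notin [:: d; 17; 18] -> reg s1 x = reg s x.
  by move=> xd; apply: exec_frame; apply: contra xd; apply: written_address.
rewrite -IH // -/s1; set s2 := set_reg s1 18 0.
have -> : exec (address d rs ;; Const 18 0 ;; For 17 1 (Add 18 18 d) ;; Add d 18 r) s =
  exec (Add d 18 r) (exec (For 17 1 (Add 18 18 d)) s2) by [].
have s21 : reg s2 1 = reg s 1 by rewrite /= /upd /= fr // !inE eq_sym (negbTE d1).
pose I i s' := [/\ reg s' 18 = i * reg s1 d, reg s' d = reg s1 d & reg s' r = reg s r].
have : I (reg s2 1) (exec (For 17 1 (Add 18 18 d)) s2).
  move: rd; rewrite !inE !negb_or => /and3P[rd r17 r18].
  apply: for_ind.
  - by move=> i s' v [e1 e2 e3]; split; rewrite /= /upd ?(negbTE d17) ?(negbTE r17).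
  - by split; rewrite /= /upd ?(negbTE d18) ?(negbTE r18) // fr // !inE !negb_or rd r17.
  - move=> i s' _ _ [e1 e2 e3]; split; rewrite /= /upd /= ?(negbTE d18) ?(negbTE r18) //.
    by rewrite e1 e2 mulSn addnC.
rewrite s21; case: (exec _ s2) => m h [/= e1 _ e3].
by rewrite /upd eqxx e1 e3 mulnC.
Qed.

(** With truncated subtraction, [x + (v - x)] is the maximum of [x] and [v]. *)
Definition relax (a v : nat) : cmd :=
  Get 1 23 a ;; Sub 24 v 23 ;; Add 23 23 24 ;; Put 1 a 23.

Definition table (Z : nat) (h : nat -> nat) (vs : seq nat) : nat := h (cell Z 1 (index_of Z vs)).

Definition raise (Z : nat) (h : nat -> nat) (vs : seq nat) (v : nat) : nat -> nat :=
  upd h (cell Z 1 (index_of Z vs)) (maxn (table Z h vs) v).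

Lemma heap_relax a v s vs : a \notin [:: 23; 24] -> v \notin [:: 23; 24] -> 
  reg s a = index_of (reg s 1) vs ->
  heap (exec (relax a v) s) = raise (reg s 1) (heap s) vs (reg s v).
Proof.
rewrite !inE !negb_or => /andP[a23 a24] /andP[v23 v24] ea.
rewrite /raise /table /= /upd /= (negbTE a23) (negbTE a24) (negbTE v23) ea.
by rewrite maxnE.
Qed.

Definition transfer (rs rs1 rs2 : seq nat) : cmd :=
  address 19 rs ;; address 20 rs1 ;; address 21 rs2 ;;
  Get 1 20 20 ;; Get 1 21 21 ;; Add 22 20 21 ;; relax 19 22.

Lemma heap_transfer rs rs1 rs2 s :
  all (fun r => (1 < r < 17)) (rs ++ rs1 ++ rs2) ->
  let T rs := table (reg s 1) (heap s) (map (reg s) rs) in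
  heap (exec (transfer rs rs1 rs2) s) =
  raise (reg s 1) (heap s) (map (reg s) rs) (T rs1 + T rs2).
Proof.
rewrite !all_cat => /and3P[a0 a1 a2] T.
have ok d rs' : all (fun r => 1 < r < 17) rs' -> 18 < d ->
    d \notin [:: 1; 17; 18] /\ all (fun r => r \notin [:: d; 17; 18]) rs'.
  move=> a' d18; split; first by rewrite !inE; lia.
  by apply: sub_all a' => r; rewrite !inE; lia.
have fr d rs' (s' : state) r : (r \notin [:: d; 17; 18]) -> reg (exec (address d rs') s') r = reg s' r.
  by move=> rd; apply: exec_frame; apply: contra rd; apply: written_address.
have frs d rs' rs'' (s' : state) : all (fun r => 1 < r < 17) rs' -> 18 < d ->
    map (reg (exec (address d rs'') s')) rs' = map (reg s') rs'.
  move=> a' d18; apply/eq_in_map => r rr; apply: fr.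
  by case: (ok d rs' a' d18) => _ /allP; apply.
have [o1 o2] := ok 19 rs a0 isT; have [o3 o4] := ok 20 rs1 a1 isT; have [o5 o6] := ok 21 rs2 a2 isT.
rewrite /transfer.
set s1 := exec (address 19 rs) s; set s2 := exec (address 20 rs1) s1.
set s3 := exec (address 21 rs2) s2.
have h3 : heap s3 = heap s by rewrite !exec_storeless // storeless_address.
have e1 : reg s3 1 = reg s 1 by rewrite !fr.
have e19 : reg s3 19 = index_of (reg s 1) (map (reg s) rs) by rewrite /s3 fr // /s2 fr // /s1 exec_address.
have e20 : reg s3 20 = index_of (reg s 1) (map (reg s) rs1).
  by rewrite /s3 fr // /s2 exec_address // /s1 fr // frs.
have e21 : reg s3 21 = index_of (reg s 1) (map (reg s) rs2).
  by rewrite /s3 exec_address // /s2 /s1 !fr // !frs.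
set s4 := exec (Add 22 20 21) (exec (Get 1 21 21) (exec (Get 1 20 20) s3)).
have -> : exec (address 19 rs;; address 20 rs1;; address 21 rs2;; Get 1 20 20;; Get 1 21 21;;
           Add 22 20 21;; relax 19 22) s = exec (relax 19 22) s4 by [].
have e22 : reg s4 22 = T rs1 + T rs2.
  by rewrite /s4 /= /upd /= h3 e20 e21 e1.
rewrite (@heap_relax 19 22 s4 (map (reg s) rs)) //.
- by rewrite e22; rewrite /s4 /= /upd /= h3 e1.
- by rewrite /s4 /= /upd /= e1.
Qed.

(** Coordinate [i] of a cut is held in register [3 + i], so the index lists for boxes also name
    registers. *)
Definition regs (ix : seq nat) : seq nat := map (addn 3) ix.

(** The sum of the truncated differences is zero exactly when all inequalities hold; subtracting it
    from 1 gives the truth value. *)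
Definition guard : cmd :=
  foldl (fun c xy => c ;; Sub 18 (3 + xy.1) (3 + xy.2) ;; Add 16 16 18) (Const 16 0) cut_pairs ;;
  Const 15 1 ;; Sub 16 15 16.

Definition combine : cmd :=
  guard ;;
  When 16 (transfer (regs whole) (regs sum1) (regs sum2) ;;
           transfer (regs whole) (regs skew1) (regs skew2)).

(** Register 12 holds the position [p]. Register 22 doubles in every pass, register 21 only in those
    of index above [p], of which there are [Z.-1 - p]. *)
Definition power : cmd :=
  Const 22 1 ;; Const 21 1 ;;
  For 17 1 (Add 22 22 22 ;; Sub 18 17 12 ;; When 18 (Add 21 21 21)) ;;
  Add 22 22 21.

Definition seed_box : cmd :=
  Const 15 2 ;; Add 11 15 12 ;; Get 0 5 11 ;; Const 15 1 ;; Const 16 0 ;;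
  Add 3 12 16 ;; Add 4 12 15 ;; Add 6 5 15 ;; Add 7 13 16 ;; Add 8 13 15 ;; Add 10 9 15.

(** The two nested tests are those of [valid_pair]. The offset 2 skips the two lengths at the head
    of the input. *)
Definition seed : cmd :=
  Sub 16 0 12 ;;
  When 16 (Const 15 2 ;; Add 11 15 0 ;; Add 11 11 13 ;; Get 0 9 11 ;;
    When 9 (seed_box ;; power ;; address 19 (iota 3 8) ;; relax 19 22)).

(** Position 0 has the top bit, so that doubling, in the absence of halving, brings out the
    positions in increasing order. *)
Definition bit_weight (Z p : nat) : nat := 2 ^ Z + 2 ^ (Z.-1 - p).

(** The successors are bounded too, since they are the upper ends of the unit boxes and must be
    digits in base [Z]. *)
Definition coords_lt (n Z : nat) (f g : nat -> nat) : Prop :=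
  (forall p, p < n -> p.+1 < Z /\ (f p).+1 < Z) /\
  (forall q, g q != 0 -> q.+1 < Z /\ (g q).+1 < Z).

(* Array 0 holds the input from index 2 on, array 1 the table, array 2 the characteristic
   function of the chosen positions and array 3 the output. *)
Definition holds_inputs (n Z : nat) (f g h : nat -> nat) : Prop :=
  (forall p, p < n -> h (cell Z 0 (2 + p)) = f p) /\
  (forall q, q < Z -> h (cell Z 0 (2 + n + q)) = g q).

(** An equality rather than an upper bound: the final entry is decoded, so it has to be the weight
    of some matching. *)
Definition sound (n Z : nat) (f g h : nat -> nat) : Prop :=
  forall vs, size vs = 8 -> all (fun v => v < Z) vs ->
  exists2 ps, matching f g (valid_pair n g) vs ps & table Z h vs = weight (bit_weight Z) ps.

Definition complete (n Z : nat) (f g : nat -> nat) (r : nat) (h : nat -> nat) : Prop :=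
  forall vs v, size vs = 8 -> all (fun v => v < Z) vs ->
  derives f g (valid_pair n g) (bit_weight Z) r vs v -> v <= table Z h vs.

Lemma raise_inputs n Z f g h vs v :
  holds_inputs n Z f g h -> holds_inputs n Z f g (raise Z h vs v).
Proof.
by case=> H1 H2; split=> p pn; rewrite /raise /upd; case: eqP => [/cell_inj[]//|_]; auto.
Qed.

Lemma raise_sound n Z f g h vs v : size vs = 8 -> all (fun v => v < Z) vs ->
  (exists2 ps, matching f g (valid_pair n g) vs ps & v = weight (bit_weight Z) ps) ->
  sound n Z f g h -> sound n Z f g (raise Z h vs v).
Proof.
move=> svs avs [ps mps ->] S us sus aus; rewrite {1}/table /raise /upd.
case: eqP => [/cell_inj[]// _ E|_]; last exact: S.
have {E} -> : us = vs by apply: index_of_inj E; rewrite ?sus.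
have [ps' mps' ->] := S vs svs avs.
by rewrite /maxn; case: ltnP => _; [exists ps | exists ps'].
Qed.

Lemma table_raise_ge Z h us vs v : table Z h us <= table Z (raise Z h vs v) us.
Proof. by rewrite {2}/table /raise /upd; case: eqP => // E; rewrite /table E leq_maxl. Qed.

Lemma table_raise Z h vs v : v <= table Z (raise Z h vs v) vs.
Proof. by rewrite /table /raise /upd eqxx leq_maxr. Qed.

Lemma reg_set_reg s r v x : reg (set_reg s r v) x = if x == r then v else reg s x.
Proof. by []. Qed.

Lemma heap_set_reg s r v : heap (set_reg s r v) = heap s.
Proof. by []. Qed.

Lemma exec_seq c1 c2 s : exec (c1 ;; c2) s = exec c2 (exec c1 s).
Proof. by []. Qed.

Lemma exec_const r v s : exec (Const r v) s = set_reg s r v.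
Proof. by []. Qed.

Lemma exec_add r a b s : exec (Add r a b) s = set_reg s r (reg s a + reg s b).
Proof. by []. Qed.

Lemma exec_sub r a b s : exec (Sub r a b) s = set_reg s r (reg s a - reg s b).
Proof. by []. Qed.

Lemma exec_get k r a s : exec (Get k r a) s = set_reg s r (heap s (cell (reg s 1) k (reg s a))).
Proof. by []. Qed.

Lemma exec_when r c s : exec (When r c) s = if reg s r == 0 then s else exec c s.
Proof. by []. Qed.

Lemma exec_seed_box s v : heap s (cell (reg s 1) 0 (2 + reg s 12)) = v ->
  map (reg (exec seed_box s)) (iota 3 8) =
  [:: reg s 12 + 0; reg s 12 + 1; v; v + 1; reg s 13 + 0; reg s 13 + 1; reg s 9; reg s 9 + 1].
Proof. by move<-. Qed.

Definition exec_assign := (exec_const, exec_add, exec_sub, exec_get).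

Local Arguments exec : simpl never.
Local Arguments set_reg : simpl never.
Local Opaque exec set_reg.

Lemma exec_power s : reg s 12 < reg s 1 ->
  reg (exec power s) 22 = bit_weight (reg s 1) (reg s 12).
Proof.
move=> pZ; rewrite /power.
set c := For 17 _ _; set s1 := exec (Const 21 1) (exec (Const 22 1) s).
have -> : exec (Const 22 1 ;; Const 21 1 ;; c ;; Add 22 22 21) s = exec (Add 22 22 21) (exec c s1) by [].
pose I i s' := [/\ reg s' 22 = 2 ^ i, reg s' 21 = 2 ^ (i.-1 - reg s 12) & reg s' 12 = reg s 12].
have : I (reg s1 1) (exec c s1).
  apply: for_ind => // i s' _ i17 [e22 e21 e12].
  split; rewrite !exec_seq !exec_assign exec_when exec_add !reg_set_reg /=.
  - by case: eqP; rewrite !reg_set_reg /= e22 expnS mul2n addnn.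
  - rewrite i17 e12; case: eqP => [|/eqP] ip; rewrite !reg_set_reg /= e21.
      by congr (2 ^ _); lia.
    by rewrite addnn -mul2n -expnS; congr (2 ^ _); lia.
  - by case: eqP; rewrite !reg_set_reg /= e12.
have -> : reg s 1 = reg s1 1 by rewrite /s1 !exec_const !reg_set_reg.
have e12 : reg s1 12 = reg s 12 by rewrite /s1 !exec_const !reg_set_reg.
by move: (exec c s1) => s2 [e22 e21 _]; rewrite exec_add reg_set_reg /= e22 e21.
Qed.

Lemma seed_correct n Z f g s : coords_lt n Z f g ->
  reg s 0 = n -> reg s 1 = Z -> reg s 13 < Z ->
  holds_inputs n Z f g (heap s) -> 
  heap (exec seed s) = if valid_pair n g (reg s 12, reg s 13)
    then raise Z (heap s) (unit_box f g (reg s 12, reg s 13)) (bit_weight Z (reg s 12))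
    else heap s.
Proof.
move=> [cf cg] s0 s1 qZ [Hf Hg]; rewrite /valid_pair /=.
rewrite /seed exec_seq exec_when exec_sub reg_set_reg /= s0 subn_eq0; case: leqP => //= pn.
do 4 (rewrite exec_seq exec_assign ?(reg_set_reg, heap_set_reg) /=).
rewrite exec_when reg_set_reg /= s1 s0 Hg //; case: eqP => //= gq.
set s3 := (X in exec (seed_box ;; _) X).
rewrite exec_seq exec_seq; set s' := exec seed_box s3.
have fr3 r : r \notin [:: 16; 15; 11; 9] -> reg s3 r = reg s r.
  by rewrite !inE !negb_or /s3 !reg_set_reg => /and4P[/negbTE-> /negbTE-> /negbTE-> /negbTE->].
have h3 : heap s3 = heap s by [].
have fr' r : (r < 3) || (11 < r < 15) -> reg s' r = reg s r.
  by move=> ?; rewrite exec_frame ?fr3 // /= !inE; lia.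
have e12 : reg s' 12 = reg s 12 by rewrite fr'.
have e1 : reg s' 1 = Z by rewrite fr'.
have e38 : map (reg s') (iota 3 8) = unit_box f g (reg s 12, reg s 13).
  rewrite /s' (exec_seed_box (v := f (reg s 12))).
    by rewrite /s3 !reg_set_reg /= !addn0 !addn1.
  by rewrite h3 !fr3 // s1 Hf.
have p_frame r : r \notin [:: 22; 21; 17; 18] -> reg (exec power s') r = reg s' r.
  by move=> rn; apply: exec_frame; move: rn; rewrite !inE /=; lia.
have e22 : reg (exec power s') 22 = bit_weight Z (reg s 12).
  by rewrite exec_power e12 e1 //; case: (cf _ pn) => /ltnW.
have hp : heap (exec power s') = heap s by rewrite !exec_storeless.
move: (exec power s') p_frame e22 hp => s2 fr e22 hp.
have e38' : map (reg s2) (iota 3 8) = unit_box f g (reg s 12, reg s 13).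
  by rewrite -e38; apply/eq_in_map => r; rewrite mem_iota => ?; apply: fr; rewrite !inE; lia.
have fa r : r \notin [:: 19; 17; 18] -> reg (exec (address 19 (iota 3 8)) s2) r = reg s2 r.
  by move=> rd; apply: exec_frame; apply: contra rd; apply: written_address.
rewrite exec_seq; move: (storeless_address 19 (iota 3 8)) fa => st fa.
have ea := @exec_address 19 (iota 3 8) s2 isT isT.
rewrite (@heap_relax 19 22 _ (unit_box f g (reg s 12, reg s 13))) //.
  by rewrite (exec_storeless _ st) hp (fa 1) // (fa 22) // (fr 1) // e1 e22.
by rewrite ea (fa 1) // (fr 1) // e1 e38'.
Qed.

Lemma exec_guard s : (reg (exec guard s) 16 == 0) = ~~ cut_ok (map (reg s) (iota 3 12)).
Proof.
have -> : reg (exec guard s) 16 = 1 - (0 +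
   (reg s 3 - reg s 11) + (reg s 11 - reg s 4) + (reg s 5 - reg s 12) + (reg s 12 - reg s 6) +
   (reg s 7 - reg s 13) + (reg s 13 - reg s 8) + (reg s 9 - reg s 14) + (reg s 14 - reg s 10)) by [].
rewrite subn_eq0 lt0n add0n !addn_eq0 !subn_eq0 /cut_ok /= andbT.
by rewrite -!andbA.
Qed.

Lemma written_transfer rs rs1 rs2 r : r \in written (transfer rs rs1 rs2) -> 16 < r < 25.
Proof.
rewrite /transfer [written _]/= !mem_cat.
by case/or4P=> [/written_address|/written_address|/written_address|]; rewrite !inE; lia.
Qed.

Lemma combine_correct Z s us : reg s 1 = Z -> us = map (reg s) (iota 3 12) ->
  heap (exec combine s) =
  if cut_ok us then
    let h := raise Z (heap s) (sel whole us)
               (table Z (heap s) (sel sum1 us) + table Z (heap s) (sel sum2 us)) in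
    raise Z h (sel whole us) (table Z h (sel skew1 us) + table Z h (sel skew2 us))
  else heap s.
Proof.
move=> s1 usE; rewrite /combine exec_seq exec_when exec_guard -usE.
have fr r : r \notin [:: 15; 16; 18] -> reg (exec guard s) r = reg s r.
  by move=> rn; apply: exec_frame; move: rn; rewrite !inE /=; lia.
have fr' r : r < 15 -> reg (exec guard s) r = reg s r by move=> ?; rewrite fr // !inE; lia.
have hE : heap (exec guard s) = heap s by apply: exec_storeless.
move: (exec guard s) fr' hE => s' {}fr hE.
case: (cut_ok us); last exact: hE.
rewrite exec_seq.
set rs := regs; have E (s2 : state) ix : (forall r, r < 15 -> reg s2 r = reg s r) -> all (fun i => i < 12) ix ->
    map (reg s2) (regs ix) = sel ix us.
  move=> f2 /allP ix12; rewrite /regs -map_comp /sel; apply/eq_in_map => i ii /=.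
  have i12 := ix12 _ ii; rewrite f2; last by clear -i12; lia.
  by rewrite usE (nth_map 0) ?size_iota // nth_iota.
set s2 := exec (transfer _ _ _) s'.
have fr2 r : r < 15 -> reg s2 r = reg s r.
  move=> r15; rewrite /s2 exec_frame ?fr //; apply: contraL r15 => /written_transfer; lia.
have h2 : heap s2 = raise Z (heap s) (sel whole us)
    (table Z (heap s) (sel sum1 us) + table Z (heap s) (sel sum2 us)).
  by rewrite /s2 heap_transfer // !E // fr // s1 hE.
by rewrite heap_transfer // !E // fr2 // s1 h2.
Qed.

Lemma size_sel ix us : size (sel ix us) = size ix.
Proof. by rewrite size_map. Qed.

Lemma all_sel ix us (P : pred nat) : all P us -> all (fun i => i < size us) ix -> all P (sel ix us).
Proof. by move=> /all_nthP H /allP ixs; rewrite all_map; apply/allP => i /ixs /H; apply. Qed.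

Lemma complete_raise n Z f g r h vs v :
  complete n Z f g r h -> complete n Z f g r (raise Z h vs v).
Proof. by move=> H us u s8 a D; apply: leq_trans (table_raise_ge _ _ _ _ _); apply: H D. Qed.

(** The cut points lie between the ends of the boxes, so every cut of a box within range is met by
    the loops. *)
Lemma cut_bounded Z us : size us = 12 -> cut_ok us ->
  all (fun v => v < Z) (sel whole us) -> all (fun v => v < Z) us.
Proof.
case/size12=> i [j [a [b [i' [j' [a' [b' [k [c [k' [c' ->]]]]]]]]]]].
by rewrite /cut_ok /=; lia.
Qed.

Definition stage (n Z : nat) (f g : nat -> nat) (r : nat) (h : nat -> nat) : Prop :=
  [/\ holds_inputs n Z f g h, sound n Z f g h & complete n Z f g r h].

Lemma seed_stage n Z f g s : coords_lt n Z f g -> reg s 0 = n -> reg s 1 = Z ->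
  holds_inputs n Z f g (heap s) -> (forall i, heap s (cell Z 1 i) = 0) ->
  stage n Z f g 0 (heap (exec (nest [:: 12; 13] seed) s)).
Proof.
move=> cl s0 s1 hi h0.
have sd : sound n Z f g (heap s).
  by move=> vs _ _; exists [::] => //; rewrite /table h0 /weight big_nil.
pose G vs h := valid_pair n g (nth 0 vs 0, nth 0 vs 1) ->
  bit_weight Z (nth 0 vs 0) <= table Z h (unit_box f g (nth 0 vs 0, nth 0 vs 1)).
have [] := @nest_ind n Z [:: 12; 13] seed (fun h => holds_inputs n Z f g h /\ sound n Z f g h) G
  isT isT isT isT _ s s0 s1 (conj hi sd).
  move=> {hi sd h0 s0 s1} {}s s0 s1 /= /and3P[pZ qZ _] [hi sd].
  rewrite (seed_correct cl) //; case: ifP => vp; last by split=> //; rewrite /G /= vp.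
  have [cf cg] := cl; have := vp; rewrite {1}/valid_pair /= => /andP[/cf[? ?] /cg[? ?]].
  split; last by move=> _; apply: table_raise.
    split; first exact: raise_inputs.
    apply: raise_sound => //; first by rewrite /=; lia.
    exists [:: (reg s 12, reg s 13)]; last by rewrite /weight big_seq1.
    by rewrite /matching /= vp !leqnn.
  by move=> vs Gvs vp'; apply: leq_trans (Gvs vp') (table_raise_ge _ _ _ _ _).
move: (heap (exec _ _)) => h [hi' sd'] GG; split=> // vs v s8 av D.
(* At depth 0 only the value 0 and the unit boxes are derivable. *)
case: D s8 av => // r [p q] vp _ av.
apply: (GG [:: p; q]) => //.
by case/and3P: av => pZ _ /and3P[_ _ /and3P[qZ _ _]]; rewrite /= pZ qZ.
Qed.

(** A derivation of depth [r.+1] may end with a cut into parts of depth [r]. That cut is visited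
    during the round, when the table dominates both parts, and entries never decrease. Reading
    entries already raised in the same round is harmless, as the invariants at [r] persist
    throughout. *)
Lemma combine_stage n Z f g r s : reg s 0 = n -> reg s 1 = Z ->
  stage n Z f g r (heap s) -> stage n Z f g r.+1 (heap (exec (nest (iota 3 12) combine) s)).
Proof.
move=> s0 s1 st.
pose D := derives f g (valid_pair n g) (bit_weight Z) r.
pose G us h := cut_ok us ->
  (forall v1 v2, D (sel sum1 us) v1 -> D (sel sum2 us) v2 -> v1 + v2 <= table Z h (sel whole us)) /\
  (forall v1 v2, D (sel skew1 us) v1 -> D (sel skew2 us) v2 -> v1 + v2 <= table Z h (sel whole us)).
have [] := @nest_ind n Z (iota 3 12) combine (stage n Z f g r) G isT isT isT isT _ s s0 s1 st.
  move=> {st s0 s1} {}s s0 s1 av [hi sd co].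
  rewrite (combine_correct s1 erefl); set us := map _ _ in av *.
  have us12 : size us = 12 by [].
  case: ifP => ok; last by split=> //; rewrite /G ok.
  have asel ix : all (fun i => i < 12) ix -> all (fun v => v < Z) (sel ix us) by move=> ?; apply: all_sel; rewrite ?us12.
  cbv zeta; set h1 := raise Z (heap s) _ _; set h2 := raise Z h1 _ _.
  have hi1 : holds_inputs n Z f g h1 by apply: raise_inputs.
  have co1 : complete n Z f g r h1 by apply: complete_raise.
  have sd1 : sound n Z f g h1.
    apply: raise_sound; rewrite ?asel //.
    have [ps1 m1 ->] := sd (sel sum1 us) (size_sel _ _) (asel sum1 isT).
    have [ps2 m2 ->] := sd (sel sum2 us) (size_sel _ _) (asel sum2 isT).
    exists (ps1 ++ ps2); last by rewrite /weight big_cat.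
    by apply: matching_cut => //; left.
  split.
  - split; [exact: raise_inputs | | exact: complete_raise].
    apply: raise_sound; rewrite ?asel //.
    have [ps1 m1 ->] := sd1 (sel skew1 us) (size_sel _ _) (asel skew1 isT).
    have [ps2 m2 ->] := sd1 (sel skew2 us) (size_sel _ _) (asel skew2 isT).
    exists (ps1 ++ ps2); last by rewrite /weight big_cat.
    by apply: matching_cut => //; right.
  - move=> vs Gvs ok'; have [H1 H2] := Gvs ok'; split=> v1 v2 D1 D2.
      by apply: leq_trans (H1 _ _ D1 D2) _; apply: leq_trans (table_raise_ge _ _ _ _ _); apply: table_raise_ge.
    by apply: leq_trans (H2 _ _ D1 D2) _; apply: leq_trans (table_raise_ge _ _ _ _ _); apply: table_raise_ge.
  - move=> _; split=> v1 v2 D1 D2.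
      apply: leq_trans (table_raise_ge _ _ _ _ _); apply: leq_trans (table_raise _ _ _ _).
      by apply: leq_add; apply: co; rewrite ?asel.
    apply: leq_trans (table_raise _ _ _ _).
    by apply: leq_add; apply: co1; rewrite ?asel.
move: (heap (exec _ _)) => h [hi sd co] GG; split=> // vs v s8 av.
move Er: r.+1 => r1 DD; case: DD Er s8 av => {vs v}.
- by [].
- by move=> {}r1 x vp _ s8 av; apply: co => //; apply: derives1.
- move=> r2 us v1 v2 us12 ok D1 D2 [E] _ av; rewrite -E in D1 D2.
  have aus : all (fun v => v < Z) us by apply: cut_bounded.
  by have [H _] := GG us us12 aus ok; apply: H.
- move=> r2 us v1 v2 us12 ok D1 D2 [E] _ av; rewrite -E in D1 D2.
  have aus : all (fun v => v < Z) us by apply: cut_bounded.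
  by have [_ H] := GG us us12 aus ok; apply: H.
Qed.

Lemma rounds_stage n Z f g s : reg s 0 = n -> reg s 1 = Z ->
  stage n Z f g 0 (heap s) ->
  stage n Z f g Z (heap (exec (For 2 1 (nest (iota 3 12) combine)) s)).
Proof.
move=> s0 s1 st.
pose I r s := [/\ reg s 0 = n, reg s 1 = Z & stage n Z f g r (heap s)].
suff [] : I (reg s 1) (exec (For 2 1 (nest (iota 3 12) combine)) s) by rewrite s1.
apply: for_ind => // r s' _ _ [e0 e1 st']; split; last exact: combine_stage.
  by rewrite exec_frame.
by rewrite exec_frame.
Qed.

Local Opaque address.

(** * Decoding the best weight *)

Definition tail_mask (B : pred nat) (Z j : nat) : nat := \sum_(j <= p < Z) B p * 2 ^ (Z.-1 - p).

Lemma tail_maskS B Z j : j < Z ->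
  tail_mask B Z j = B j * 2 ^ (Z.-1 - j) + tail_mask B Z j.+1.
Proof. exact: big_ltn. Qed.

Lemma tail_mask_lt B Z j : j <= Z -> tail_mask B Z j < 2 ^ (Z - j).
Proof.
move=> jZ; rewrite -{1}(subKn jZ); elim: (Z - j) (leq_subr j Z) => [|d IH] dZ.
  by rewrite subn0 /tail_mask big_geq // expn0.
rewrite tail_maskS; last by rewrite ltn_subrL (leq_trans _ dZ).
have -> : (Z - d.+1).+1 = Z - d by lia.
have -> : Z.-1 - (Z - d.+1) = d by lia.
rewrite expnS mul2n -addnn -addnS; apply: leq_add (IH (ltnW dZ)).
by case: (B _); rewrite ?mul1n.
Qed.

Definition chosen (ps : seq (nat * nat)) : pred nat := fun p => p \in map fst ps.

(** The positions are distinct, so the low powers of two add up without carries to the binary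
    expansion of the set. *)
Lemma weight_mask Z ps : sorted ltn (map fst ps) -> all (fun p => p < Z) (map fst ps) ->
  weight (bit_weight Z) ps = size ps * 2 ^ Z + tail_mask (chosen ps) Z 0.
Proof.
move=> sP PZ; rewrite /weight big_split /= big_const_seq count_predT iter_addn_0 mulnC.
congr (_ + _); rewrite -(big_map fst xpredT (fun p => 2 ^ (Z.-1 - p))).
rewrite /tail_mask {1}(ltn_sortedE sP PZ) big_filter big_mkcond.
rewrite /index_iota subn0; apply: eq_bigr => p _.
by rewrite /chosen; case: (p \in _); rewrite ?mul1n.
Qed.

(** The low part is less than [2 ^ Z], so it cannot outweigh a difference in size. *)
Lemma weight_size Z ps ps' : 
  sorted ltn (map fst ps) -> all (fun p => p < Z) (map fst ps) ->
  sorted ltn (map fst ps') -> all (fun p => p < Z) (map fst ps') ->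
  weight (bit_weight Z) ps <= weight (bit_weight Z) ps' -> size ps <= size ps'.
Proof.
move=> s1 a1 s2 a2; rewrite !weight_mask // => H; rewrite -ltnS.
rewrite -(ltn_pmul2r (expn_gt0 2 Z)); apply: leq_ltn_trans (leq_addr _ _) (leq_ltn_trans H _).
by rewrite mulSn addnC ltn_add2r; have := tail_mask_lt (chosen ps') (leq0n Z); rewrite subn0.
Qed.

(** The box has upper bound [Z.-1], the largest coordinate that is a digit in base [Z]. *)
Definition read_best : cmd :=
  Const 15 1 ;; Const 3 0 ;; Sub 4 1 15 ;; address 19 [:: 3; 4; 3; 4; 3; 4; 3; 4] ;; Get 1 22 19.

Definition two_power : cmd := Const 21 1 ;; For 17 1 (Add 21 21 21).

(** Reduces modulo [2 ^ Z] by [Z] conditional subtractions, enough because the size is at most [Z].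
    Register 18 ends as 1 exactly when [2 ^ Z] can be subtracted. *)
Definition drop_size : cmd :=
  For 17 1 (Sub 18 21 22 ;; Sub 18 15 18 ;; When 18 (Sub 22 22 21)).

(** After a doubling, the bit of the current position has value [2 ^ Z] and the later ones total
    less, so one comparison reads it. *)
Definition decode : cmd :=
  For 12 0 (Add 22 22 22 ;; Const 20 0 ;; Sub 18 21 22 ;; Sub 18 15 18 ;;
            When 18 (Sub 22 22 21 ;; Const 20 1) ;; Put 2 12 20).

Lemma exec_put k a b s :
  exec (Put k a b) s = set_heap s (cell (reg s 1) k (reg s a)) (reg s b).
Proof. by []. Qed.

Lemma exec_read_best s : 0 < reg s 1 ->
  let s' := exec read_best s in
  [/\ reg s' 22 = table (reg s 1) (heap s) (full_box (reg s 1).-1), reg s' 15 = 1 & heap s' = heap s].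
Proof.
move=> Z0; rewrite /read_best; cbv zeta.
rewrite 4!exec_seq 2!exec_const exec_sub exec_get.
set s1 := set_reg (set_reg _ 3 0) 4 _.
have fr r : r \notin [:: 19; 17; 18] -> reg (exec (address 19 [:: 3; 4; 3; 4; 3; 4; 3; 4]) s1) r = reg s1 r.
  by move=> rd; apply: exec_frame; apply: contra rd; apply: written_address.
have ea := @exec_address 19 [:: 3; 4; 3; 4; 3; 4; 3; 4] s1 isT isT.
have st := exec_storeless s1 (storeless_address 19 [:: 3; 4; 3; 4; 3; 4; 3; 4]).
move: (exec _ s1) fr ea st => s2 fr ea st.
rewrite !reg_set_reg heap_set_reg /= ea !fr // st /s1 /= !reg_set_reg /= subn1.
by split.
Qed.

Lemma exec_two_power s : reg (exec two_power s) 21 = 2 ^ reg s 1.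
Proof.
rewrite /two_power exec_seq exec_const.
pose I i (s : state) := reg s 21 = 2 ^ i.
have -> : reg s 1 = reg (set_reg s 21 1) 1 by rewrite reg_set_reg.
apply: (@for_ind I).
- by move=> i s' v; rewrite /I reg_set_reg.
- by rewrite /I reg_set_reg.
- by move=> i s' _ _; rewrite /I exec_add !reg_set_reg /= => ->; rewrite addnn -mul2n expnS.
Qed.

Lemma exec_drop_size s k t : k <= reg s 1 -> reg s 15 = 1 -> reg s 21 = 2 ^ reg s 1 ->
  t < 2 ^ reg s 1 -> reg s 22 = k * 2 ^ reg s 1 + t ->
  reg (exec drop_size s) 22 = t.
Proof.
move=> kZ s15 s21 tQ s22; set Q := 2 ^ reg s 1 in s21 tQ s22.
pose I i (s : state) := [/\ reg s 15 = 1, reg s 21 = Q & reg s 22 = (k - i) * Q + t].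
suff [_ _] : I (reg s 1) (exec drop_size s).
  by have /eqP -> : k - reg s 1 == 0 by rewrite subn_eq0.
apply: for_ind.
- by move=> i s' v [? ? ?]; split; rewrite !reg_set_reg.
- by split; rewrite // subn0.
move=> i s' _ _ [e15 e21 e22].
rewrite /I !exec_seq !exec_assign exec_when exec_sub !reg_set_reg /= e15 e21 e22.
have E : (1 - (Q - ((k - i) * Q + t)) == 0) = (k - i == 0).
  case: (k - i) => [|d]; first by rewrite mul0n add0n subn_eq0 subn_gt0.
  by rewrite mulSn -addnA subnDA subnn sub0n.
rewrite E; case: eqP => E'; rewrite !reg_set_reg /= ?e15 ?e21 ?e22.
  by split=> //; have -> : k - i.+1 = k - i by lia.
split=> //; have -> : k - i = (k - i.+1).+1 by lia.
by rewrite mulSn -addnA addKn.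
Qed.

Lemma exec_decode s B : reg s 0 <= reg s 1 -> 
  reg s 15 = 1 -> reg s 21 = 2 ^ reg s 1 -> reg s 22 = tail_mask B (reg s 1) 0 ->
  let s' := exec decode s in
  (forall p, p < reg s 0 -> heap s' (cell (reg s 1) 2 p) = B p) /\
  (forall a, (forall p, a <> cell (reg s 1) 2 p) -> heap s' a = heap s a).
Proof.
move=> nZ s15 s21 s22; set Z := reg s 1 in nZ s21 s22 *.
pose I j (s' : state) := [/\ reg s' 1 = Z, reg s' 15 = 1, reg s' 21 = 2 ^ Z &
    reg s' 22 = 2 ^ j * tail_mask B Z j] /\
   ((forall p, p < j -> heap s' (cell Z 2 p) = B p) /\
    (forall a, (forall p, a <> cell Z 2 p) -> heap s' a = heap s a)).
suff [] : I (reg s 0) (exec decode s) by [].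
apply: for_ind.
- by move=> i s' v [[e1 e2 e3 e4] e5]; split; [split; rewrite reg_set_reg | rewrite heap_set_reg].
- by split=> //; rewrite s22 expn0 mul1n.
move=> j s' jn e12 [[e1 e15 e21 e22] [H1 H2]].
have jZ : j < Z by apply: leq_trans nZ.
rewrite /I !exec_seq exec_put !exec_assign exec_when exec_seq !exec_assign.
have Q : 2 ^ j.+1 * 2 ^ (Z.-1 - j) = 2 ^ Z by rewrite -expnD; congr (_ ^ _); lia.
have lt : 2 ^ j.+1 * tail_mask B Z j.+1 < 2 ^ Z.
  have -> : 2 ^ Z = 2 ^ j.+1 * 2 ^ (Z - j.+1) by rewrite -expnD; congr (_ ^ _); lia.
  by rewrite ltn_pmul2l ?expn_gt0 // tail_mask_lt.
have E : reg s' 22 + reg s' 22 = B j * 2 ^ Z + 2 ^ j.+1 * tail_mask B Z j.+1.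
  by rewrite e22 addnn -mul2n mulnA -expnS tail_maskS // mulnDr mulnCA Q.
set s4 := (if _ then _ else _).
have [r1 r15 r21 r22] : [/\ reg s4 1 = Z, reg s4 15 = 1, reg s4 21 = 2 ^ Z &
    reg s4 22 = 2 ^ j.+1 * tail_mask B Z j.+1].
  rewrite /s4 !reg_set_reg /= E e15 e21.
  case: (B j); rewrite ?mul1n ?mul0n ?add0n.
    by rewrite subnDA subnn sub0n /=; split; rewrite !reg_set_reg //= ?e21 ?addKn.
  have -> : (1 - (2 ^ Z - 2 ^ j.+1 * tail_mask B Z j.+1) == 0) by rewrite subn_eq0 subn_gt0.
  by split; rewrite !reg_set_reg //=.
have [r12 r20 hE] : [/\ reg s4 12 = j, reg s4 20 = B j & heap s4 = heap s'].
  rewrite /s4 !reg_set_reg /= E e15 e21.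
  case: (B j); rewrite ?mul1n ?mul0n ?add0n.
    by rewrite subnDA subnn sub0n /=; split; rewrite ?reg_set_reg ?heap_set_reg.
  have -> : (1 - (2 ^ Z - 2 ^ j.+1 * tail_mask B Z j.+1) == 0) by rewrite subn_eq0 subn_gt0.
  by split; rewrite ?reg_set_reg ?heap_set_reg.
split=> //; split=> [p pj|a aN]; rewrite /= /upd r1 r12 hE.
  case: eqP => [/cell_inj[]// _ ->//|pN]; rewrite H1 // ltn_neqAle -ltnS pj andbT.
  by apply/eqP => pE; apply: pN; rewrite pE.
by case: eqP => [/aN//|_]; apply: H2.
Qed.

(** * Ranking the chosen entries; moving input and output *)

Definition count_smaller : cmd :=
  For 13 0 (Get 2 20 13 ;;
    When 20 (Add 18 13 16 ;; Get 0 26 18 ;; Sub 18 25 26 ;; When 18 (Add 24 24 15))).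

Definition rank_step : cmd :=
  Get 2 20 12 ;;
  When 20 (Const 24 1 ;; Const 16 2 ;; Add 18 12 16 ;; Get 0 25 18 ;;
           count_smaller ;; Add 23 23 15 ;; Put 3 23 24).

(** Array 3 takes the layout required of the output: the length at index 0, then the ranks of the
    chosen entries. *)
Definition rank : cmd :=
  Const 15 1 ;; Const 23 0 ;; For 12 0 rank_step ;; Const 18 0 ;; Put 3 18 23.

(** Only output cells of index at least [nregs] are moved here; the others belong in the registers
    and wait for the epilogue. *)
Definition copy_out : cmd :=
  Const 15 nregs ;; For 12 0 (Add 18 12 15 ;; Get 3 20 18 ;; Poke 12 20).

Lemma exec_count_smaller s n Z f (B : pred nat) x :
  reg s 0 = n -> reg s 1 = Z -> reg s 15 = 1 -> reg s 16 = 2 -> reg s 24 = 1 -> reg s 25 = x ->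
  (forall p, p < n -> heap s (cell Z 0 (2 + p)) = f p) ->
  (forall p, p < n -> heap s (cell Z 2 p) = B p) ->
  reg (exec count_smaller s) 24 =
    (count (fun y => y < x) (map f [seq q <- iota 0 n | B q])).+1.
Proof.
move=> s0 s1 s15 s16 s24 s25 Hf HB.
pose C j := count (fun q => B q && (f q < x)) (iota 0 j).
have CS j : C j.+1 = C j + (B j && (f j < x)) by rewrite /C -addn1 iotaD count_cat /= addn0.
have -> : count (fun y => y < x) (map f [seq q <- iota 0 n | B q]) = C n.
  by rewrite count_map count_filter; apply: eq_count => q /=; rewrite andbC.
pose I j (s' : state) := [/\ [/\ reg s' 1 = Z, reg s' 15 = 1 & reg s' 16 = 2], reg s' 25 = x,
  reg s' 24 = (C j).+1 & heap s' = heap s].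
suff [_ _ ? _] : I (reg s 0) (exec count_smaller s) by rewrite -s0.
apply: for_ind.
- by move=> i s' v [[? ? ?] ? ? ?]; split; rewrite ?reg_set_reg ?heap_set_reg //; split; rewrite reg_set_reg.
- by [].
move=> j s'; rewrite s0 => jn e13 [[e1 e15 e16] e25 e24 hE].
rewrite /I CS exec_seq exec_get exec_when reg_set_reg [20 == 20]/= e1 e13 hE HB //.
case: (B j); last first.
  rewrite addn0 /=.
  by split; rewrite ?reg_set_reg ?heap_set_reg //; split; rewrite reg_set_reg.
rewrite [_ == 0]/= 3!exec_seq exec_when (exec_add 24).
set sA := exec (Sub 18 25 26) _.
have hA : heap sA = heap s by rewrite -hE; do 3 rewrite [LHS]exec_storeless //.
have fr r : r \notin [:: 18; 20; 26] -> reg sA r = reg s' r.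
  by move=> rn; do 3 (rewrite [LHS]exec_frame; last by move: rn; rewrite !inE /=; lia);
    rewrite reg_set_reg; case: eqP rn => // ->.
have r18 : reg sA 18 = x - f j.
  rewrite /sA exec_sub exec_get exec_add !reg_set_reg /= e25 e13 e16 e1.
  by rewrite -[heap (set_reg _ _ _)]/(heap s') hE (addnC j) Hf.
move: sA hA fr r18 => sA hA fr r18.
rewrite r18 subn_eq0; case: leqP => _; rewrite ?addn0 ?addn1.
  by rewrite !fr.
by rewrite !reg_set_reg /= !fr // e15 e24 addn1.
Qed.

Lemma exec_rank s n Z f (B : pred nat) : reg s 0 = n -> reg s 1 = Z ->
  (forall p, p < n -> heap s (cell Z 0 (2 + p)) = f p) ->
  (forall p, p < n -> heap s (cell Z 2 p) = B p) ->
  let P := [seq p <- iota 0 n | B p] in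
  let s' := exec rank s in
  heap s' (cell Z 3 0) = size P /\
  forall i, i < size P -> heap s' (cell Z 3 i.+1) = nth 0 (standardize (map f P)) i.
Proof.
move=> s0 s1 Hf HB; cbv zeta; set P := filter _ _.
pose Pj j := [seq p <- iota 0 j | B p].
have PS j : Pj j.+1 = if B j then rcons (Pj j) j else Pj j.
  by rewrite /Pj -addn1 iotaD filter_cat /=; case: (B j); rewrite ?cats1 ?cats0.
pose rk p := (count (fun y => y < f p) (map f P)).+1.
pose I j (s' : state) := [/\ [/\ reg s' 0 = n, reg s' 1 = Z & reg s' 15 = 1], 
   reg s' 23 = size (Pj j),
   forall p, p < n -> heap s' (cell Z 0 (2 + p)) = f p,
   forall p, p < n -> heap s' (cell Z 2 p) = B p &
   forall i, i < size (Pj j) -> heap s' (cell Z 3 i.+1) = rk (nth 0 (Pj j) i)].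
rewrite /rank 4!exec_seq 3!exec_const exec_put.
set s2 := set_reg (set_reg s 15 1) 23 0.
have e20 : reg s2 0 = n by rewrite /s2 !reg_set_reg.
have : I (reg s2 0) (exec (For 12 0 rank_step) s2); last first.
- rewrite e20; move: (exec _ s2) => s3 [[e0 e1 e15] e23 H0 H2 H3].
  rewrite !reg_set_reg /= e1 e23 /upd eqxx; split=> // i iP.
  case: eqP => [/cell_inj[]//|_]; rewrite H3 // (nth_map 0) ?size_map //.
  by rewrite (nth_map 0).
apply: for_ind.
- by move=> i s' v [[? ? ?] ? ? ? ?]; split; rewrite ?reg_set_reg ?heap_set_reg.
- split=> //; rewrite /s2 ?reg_set_reg //; split; rewrite ?reg_set_reg //.
- rewrite e20 => j s' jn e12 [[e0 e1 e15] e23 H0 H2 H3].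
  rewrite /I /rank_step exec_seq exec_get exec_when reg_set_reg [20 == 20]/= e1 e12 H2 // PS.
  case: (B j); last first.
    by rewrite [0 == 0]/=; split; rewrite ?reg_set_reg ?heap_set_reg.
  rewrite [_ == 0]/= 6!exec_seq exec_put.
  set s3 := exec (Get 0 25 18) _.
  have [[r0 r1 r15] [r16 r24 r25] [r12 r23] h3] : [/\ [/\ reg s3 0 = n, reg s3 1 = Z & reg s3 15 = 1],
      [/\ reg s3 16 = 2, reg s3 24 = 1 & reg s3 25 = f j],
      reg s3 12 = j /\ reg s3 23 = size (Pj j) & heap s3 = heap s'].
    have hG : heap s3 = heap s' by do 4 rewrite [LHS]exec_storeless //.
    have fr r : r \notin [:: 25; 18; 16; 24; 20] -> reg s3 r = reg s' r.
      by move=> rn; do 4 (rewrite [LHS]exec_frame; last by move: rn; rewrite !inE /=; lia);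
        rewrite reg_set_reg; case: eqP rn => // ->.
    split; [by split; rewrite fr | split | by split; rewrite fr | exact: hG].
    - by rewrite /s3 exec_get exec_add 2!exec_const !reg_set_reg.
    - by rewrite /s3 exec_get exec_add 2!exec_const !reg_set_reg.
    rewrite /s3 exec_get exec_add 2!exec_const !reg_set_reg /= e12 e1.
    by rewrite -[heap (set_reg _ _ _)]/(heap s') (addnC j) H0.
  move: s3 r0 r1 r15 r16 r24 r25 r12 r23 h3 => s3 r0 r1 r15 r16 r24 r25 r12 r23 h3.
  have E24 : reg (exec count_smaller s3) 24 = rk j.
    rewrite (@exec_count_smaller s3 n Z f B (f j)) // h3 //.
  have fr r : r \notin [:: 13; 18; 20; 24; 26] -> reg (exec count_smaller s3) r = reg s3 r.
    by move=> rn; apply: exec_frame; move: rn; rewrite !inE /=; lia.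
  have hc : heap (exec count_smaller s3) = heap s' by rewrite exec_storeless.
  move: (exec count_smaller s3) E24 fr hc => s4 E24 fr hc.
  have h5 : heap (set_heap (exec (Add 23 23 15) s4)
     (cell (reg (exec (Add 23 23 15) s4) 1) 3 (reg (exec (Add 23 23 15) s4) 23))
     (reg (exec (Add 23 23 15) s4) 24)) = upd (heap s') (cell Z 3 (size (Pj j)).+1) (rk j).
    rewrite /= exec_add !reg_set_reg /= E24 !fr // r1 r23 r15 addn1.
    by rewrite -[heap (set_reg _ _ _)]/(heap s4) hc.
  rewrite h5 size_rcons; split.
  + by rewrite /= exec_add !reg_set_reg /= !fr.
  + by rewrite /= exec_add !reg_set_reg /= !fr // r23 r15 addn1.
  + by move=> p pn; rewrite /upd; case: eqP => [/cell_inj[]//|_]; apply: H0.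
  + by move=> p pn; rewrite /upd; case: eqP => [/cell_inj[]//|_]; apply: H2.
  + move=> i; rewrite ltnS leq_eqVlt nth_rcons /upd => /orP[/eqP->|iP].
      by rewrite eqxx ltnn eqxx.
    rewrite iP; case: eqP => [/cell_inj[]// _ [E]|_]; last exact: H3.
    by rewrite E ltnn in iP.
Qed.

Lemma exec_peek r a s : exec (Peek r a) s = set_reg s r (heap s (nregs + reg s a)).
Proof. by []. Qed.

Lemma exec_poke a b s : exec (Poke a b) s = set_heap s (nregs + reg s a) (reg s b).
Proof. by []. Qed.

Lemma exec_copy_out s n Z : reg s 0 = n -> reg s 1 = Z -> nregs + n <= Z ->
  let s' := exec copy_out s in
  (forall i, i < n -> heap s' (nregs + i) = heap s (cell Z 3 (nregs + i))) /\
  (forall a, Z <= a -> heap s' a = heap s a).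
Proof.
move=> s0 s1 nZ; cbv zeta; rewrite /copy_out exec_seq exec_const.
pose I j (s' : state) := [/\ reg s' 1 = Z, reg s' 15 = nregs,
   forall i, i < j -> heap s' (nregs + i) = heap s (cell Z 3 (nregs + i)) &
   forall a, Z <= a -> heap s' a = heap s a].
have : I (reg (set_reg s 15 nregs) 0) (exec (For 12 0 (Add 18 12 15 ;; Get 3 20 18 ;; Poke 12 20)) (set_reg s 15 nregs)).
- apply: for_ind.
  + by move=> i s' v [? ? ? ?]; split; rewrite ?reg_set_reg ?heap_set_reg.
  + by split; rewrite ?reg_set_reg.
  + rewrite reg_set_reg /= s0 => j s' jn e12 [e1 e15 H1 H2].
    rewrite 2!exec_seq exec_poke; set s2 := exec (Get 3 20 18) _.
    have fr r : r \notin [:: 18; 20] -> reg s2 r = reg s' r.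
      by move=> rn; do 2 (rewrite [LHS]exec_frame; last by move: rn; rewrite !inE /=; lia).
    have hE : heap s2 = heap s' by do 2 rewrite [LHS]exec_storeless //.
    have r20 : reg s2 20 = heap s (cell Z 3 (nregs + j)).
      rewrite /s2 exec_get exec_add !reg_set_reg /= e12 e15 e1 -[heap (set_reg _ _ _)]/(heap s').
      by rewrite addnC H2 // /cell -addnA leq_addr.
    move: s2 fr hE r20 => s2 fr hE r20; rewrite fr // e12 r20.
    split; [by rewrite /= fr | by rewrite /= fr | |] => [i|a Za] /=; rewrite /upd hE.
      rewrite ltnS leq_eqVlt => /orP[/eqP->|ij]; first by rewrite eqxx.
      by rewrite eqn_add2l (ltn_eqF ij) H1.
    case: eqP => [aE|_]; last exact: H2.
    by exfalso; move: nZ Za jn; rewrite aE; clear; lia.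
- rewrite reg_set_reg /= s0; move: (exec _ _) => s' [_ _ H1 H2].
  by split.
Qed.

(** The counterpart of the prologue, which saves the input below [nregs]. Reading stops at [Z],
    where the arrays begin, so nothing just written is taken for input. *)
Definition copy_in : cmd :=
  Const 15 nregs ;;
  For 2 1 (Add 16 2 15 ;; Sub 17 1 16 ;; When 17 (Peek 18 2 ;; Put 0 16 18)).

Lemma exec_copy_in s Z : reg s 1 = Z -> nregs <= Z ->
  let s' := exec copy_in s in
  (forall i, nregs <= i < Z -> heap s' (cell Z 0 i) = heap s i) /\
  (forall a, (forall i, nregs <= i < Z -> a <> cell Z 0 i) -> heap s' a = heap s a).
Proof.
move=> s1 nZ; cbv zeta; rewrite /copy_in exec_seq exec_const.
pose I j (s' : state) := [/\ reg s' 1 = Z, reg s' 15 = nregs,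
  forall i, nregs <= i < minn (nregs + j) Z -> heap s' (cell Z 0 i) = heap s i &
  forall a, (forall i, nregs <= i < Z -> a <> cell Z 0 i) -> heap s' a = heap s a].
set body := (Add 16 2 15 ;; _).
have : I (reg (set_reg s 15 nregs) 1) (exec (For 2 1 body) (set_reg s 15 nregs)); last first.
- rewrite reg_set_reg /= s1; move: (exec _ _) => s' [_ _ H1 H2]; split=> // i iZ.
  by apply: H1; move: iZ; clear; lia.
- apply: for_ind.
  + by move=> i s' v [? ? ? ?]; split; rewrite ?reg_set_reg ?heap_set_reg.
  + split; rewrite ?reg_set_reg // => i; rewrite addn0; move: nZ; clear; lia.
  + rewrite reg_set_reg /= s1 => j s' _ e2 [e1 e15 H1 H2].
    rewrite /body 2!exec_seq exec_when; set s2 := exec (Sub 17 1 16) _.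
    have fr r : r \notin [:: 16; 17] -> reg s2 r = reg s' r.
      by move=> rn; do 2 (rewrite [LHS]exec_frame; last by move: rn; rewrite !inE /=; lia).
    have hE : heap s2 = heap s' by do 2 rewrite [LHS]exec_storeless //.
    have r16 : reg s2 16 = j + nregs by rewrite /s2 exec_sub exec_add !reg_set_reg /= e2 e15.
    have r17 : reg s2 17 = Z - (j + nregs).
      by rewrite /s2 exec_sub exec_add !reg_set_reg /= e1 e2 e15.
    move: s2 fr hE r16 r17 => s2 fr hE r16 r17; rewrite r17 subn_eq0.
    case: leqP => jZ.
      split; rewrite ?fr ?hE // => i iZ; apply: H1; move: iZ jZ; clear; lia.
    rewrite exec_seq exec_put; set s3 := exec (Peek 18 2) s2.
    have r18 : reg s3 18 = heap s (nregs + j).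
      rewrite /s3 exec_peek reg_set_reg /= fr // e2 hE H2 // => i iZ.
      by move: jZ; rewrite /cell; clear; lia.
    have r3 r : r \notin [:: 18] -> reg s3 r = reg s2 r by move=> rn; apply: exec_frame.
    have h3 : heap s3 = heap s' by rewrite -hE; apply: exec_storeless.
    move: s3 r18 r3 h3 => s3 r18 r3 h3.
    rewrite (r3 1) // (r3 16) // fr // e1 r16 r18; split; [by rewrite /= r3 // fr | by rewrite /= r3 // fr | |].
      move=> i iZ; rewrite /= /upd h3; case: eqP => [/cell_inj[]// _ ->|iN]; first by rewrite addnC.
      apply: H1; have : i <> j + nregs by move=> E; apply: iN; rewrite E.
      by move: iZ; clear; lia.
    move=> a aN; rewrite /= /upd h3; case: eqP => [E|_]; last exact: H2.
    by case: (aN (j + nregs)) => //; move: jZ; clear; lia.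
Qed.

(** * The complete search *)

Definition fill : cmd := nest [:: 12; 13] seed ;; For 2 1 (nest (iota 3 12) combine).

Definition extract : cmd := read_best ;; two_power ;; drop_size ;; decode.

Definition main : cmd := copy_in ;; fill ;; extract ;; rank ;; copy_out.

(** By soundness the entry of the full box is the weight of a matching; by completeness it is at
    least the weight of each one, so this matching has maximal size. *)
Lemma stage_max sigma tau Z h : is_perm sigma -> is_perm tau -> separable sigma ->
  size sigma + size tau < Z.-1 ->
  stage (size sigma) Z (nth 0 sigma) (nth 0 tau) Z h ->
  exists ps, let P := map fst ps in
    [/\ sorted ltn P, all (fun p => p < size sigma) P,
        table Z h (full_box Z.-1) = weight (bit_weight Z) ps &
        is_LCP (standardize (map (nth 0 sigma) P)) sigma tau].
Proof.
move=> ps pt sep lt [_ sd co].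
have Z0 : Z.-1 < Z by move: lt; clear; lia.
have av : all (fun v => v < Z) (full_box Z.-1) by rewrite /= Z0 (leq_trans _ Z0).
have fst_lt qs : matching (nth 0 sigma) (nth 0 tau) (valid_pair (size sigma) (nth 0 tau))
      (full_box Z.-1) qs -> sorted ltn (map fst qs) /\ all (fun p => p < size sigma) (map fst qs).
  case/and3P=> pw Pp _; split; first exact: compat_fst pw.
  by rewrite all_map; apply: sub_all Pp => x /andP[].
have [ps0 m0 E] := sd (full_box Z.-1) erefl av.
exists ps0; have [s0 a0] := fst_lt _ m0; split=> //.
apply: (@matching_LCP _ _ _ Z.-1) => // qs mq.
have ltZ p : p < size sigma -> p < Z by move: lt; clear; lia.
have [sq aq] := fst_lt _ mq.
apply: (@weight_size Z); rewrite ?(sub_all ltZ) //.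
rewrite -E; apply: co => //; apply: (@derives_leq _ _ _ _ (size qs).+1).
  (* The positions are distinct and below [size sigma], so the depth of the derivation is at most
     the number [Z] of rounds. *)
  apply: leq_ltn_trans (_ : size sigma < Z); last by move: lt; clear; lia.
  rewrite -(size_map fst) (ltn_sortedE sq aq) size_filter.
  by apply: leq_trans (count_size _ _) _; rewrite size_iota.
apply: derives_matching => // rs pw Pr.
by apply: separable_avoids_compat pw Pr => // x /andP[].
Qed.

Lemma fill_correct n Z f g s : coords_lt n Z f g -> reg s 0 = n -> reg s 1 = Z ->
  holds_inputs n Z f g (heap s) -> (forall i, heap s (cell Z 1 i) = 0) ->
  stage n Z f g Z (heap (exec fill s)).
Proof.
move=> cl s0 s1 hi h0; rewrite /fill exec_seq.
have st := seed_stage cl s0 s1 hi h0.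
by apply: rounds_stage => //; rewrite exec_frame.
Qed.

Lemma extract_correct n Z s ps : reg s 0 = n -> reg s 1 = Z -> n <= Z -> 0 < Z ->
  let P := map fst ps in
  sorted ltn P -> all (fun p => p < n) P ->
  table Z (heap s) (full_box Z.-1) = weight (bit_weight Z) ps ->
  (forall p, p < n -> heap (exec extract s) (cell Z 2 p) = chosen ps p) /\
  (forall a, (forall p, a <> cell Z 2 p) -> heap (exec extract s) a = heap s a).
Proof.
move=> s0 s1 nZ Z0; cbv zeta => sP aP E; rewrite /extract 3!exec_seq.
have aZ : all (fun p => p < Z) (map fst ps) by apply: sub_all aP => p /leq_trans; apply.
have szP : size ps <= Z.
  rewrite -(size_map fst) (ltn_sortedE sP aZ) size_filter.
  by apply: leq_trans (count_size _ _) _; rewrite size_iota.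
have s1_gt0 : 0 < reg s 1 by rewrite s1.
have [r22 r15 hA] := exec_read_best s1_gt0.
have fA r : r < 2 -> reg (exec read_best s) r = reg s r by case: r => [|[]] // _; rewrite exec_frame.
move: (exec read_best s) r22 r15 hA fA => s2; rewrite s1 E (weight_mask sP aZ) => r22 r15 hA fA.
have r21 := exec_two_power s2.
have hB : heap (exec two_power s2) = heap s by rewrite exec_storeless.
have fB r : r \notin [:: 17; 21] -> reg (exec two_power s2) r = reg s2 r.
  by move=> rn; apply: exec_frame; move: rn; rewrite !inE /=; lia.
move: (exec two_power s2) r21 hB fB => s3; rewrite fA // s1 => r21 hB fB.
have r31 : reg s3 1 = Z by rewrite fB // fA.
have r30 : reg s3 0 = n by rewrite fB // fA.
have r322 := @exec_drop_size s3 (size ps) (tail_mask (chosen ps) Z 0).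
rewrite r31 r21 !fB // in r322.
have mask_lt : tail_mask (chosen ps) Z 0 < 2 ^ Z.
  by have := tail_mask_lt (chosen ps) (leq0n Z); rewrite subn0.
have {}r322 := r322 szP r15 erefl mask_lt r22.
have hC : heap (exec drop_size s3) = heap s by rewrite exec_storeless.
have fC r : r \notin [:: 17; 18; 22] -> reg (exec drop_size s3) r = reg s3 r.
  by move=> rn; apply: exec_frame; move: rn; rewrite !inE /=; lia.
move: (exec drop_size s3) r322 hC fC => s4 r322 hC fC.
have r40 : reg s4 0 = n by rewrite fC.
have r41 : reg s4 1 = Z by rewrite fC.
have r45 : reg s4 15 = 1 by rewrite fC // fB.
have r421 : reg s4 21 = 2 ^ Z by rewrite fC.
have := @exec_decode s4 (chosen ps); rewrite r40 r41 => /(_ nZ r45 r421 r322) [D1 D2].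
by split=> // a aN; rewrite D2 ?hC.
Qed.

Lemma main_correct sigma tau Z s : is_perm sigma -> is_perm tau -> separable sigma ->
  reg s 0 = size sigma -> reg s 1 = Z -> nregs + size sigma + size tau < Z ->
  (forall i, 1 < i < nregs -> heap s (cell Z 0 i) = nth 0 (encode sigma tau) i) ->
  (forall i, nregs <= i < Z -> heap s i = nth 0 (encode sigma tau) i) ->
  (forall i, nregs <= i -> heap s (cell Z 0 i) = 0) ->
  (forall i, heap s (cell Z 1 i) = 0) ->
  let h := heap (exec main s) in
  exists2 rho, is_LCP rho sigma tau & 
    [/\ h (cell Z 3 0) = size rho,
        forall i, i < size rho -> h (cell Z 3 i.+1) = nth 0 rho i,
        size rho <= size sigma &
        forall i, i < size sigma -> h (nregs + i) = h (cell Z 3 (nregs + i))].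
Proof.
set n := size sigma; set f := nth 0 sigma; set g := nth 0 tau.
move=> ps pt sep s0 s1 nZ h_low h_high h_zero h_table.
have nZ' : nregs <= Z by move: nZ; clear; lia.
rewrite /main 4!exec_seq.
have [in1 in2] := exec_copy_in s1 nZ'.
have fr0 c r (s' : state) : r < 2 -> well_formed c -> reg (exec c s') r = reg s' r.
  by move=> r2 wf; apply: well_formed_frame.
(* Three ranges: below [nregs] the prologue has saved the input, up to [Z] the loop copies it, and
   from [Z] on both sides are 0. *)
have input i : 1 < i -> heap (exec copy_in s) (cell Z 0 i) = nth 0 (encode sigma tau) i.
  move=> i1; have [iK|Ki] := ltnP i nregs.
    rewrite in2 ?h_low ?i1 // => j jZ /cell_inj[]// _ E; move: jZ iK; rewrite E; clear; lia.
  have [iZ|Zi] := ltnP i Z; first by rewrite in1 ?Ki // h_high ?Ki.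
  rewrite in2 => [|j jZ /cell_inj[]// _ E]; last by move: jZ Zi; rewrite E; clear; lia.
  rewrite h_zero // nth_default // /encode /= size_cat; move: nZ Zi; rewrite /n; clear; rewrite /nregs; lia.
have a0 : reg (exec copy_in s) 0 = n by rewrite fr0.
have a1 : reg (exec copy_in s) 1 = Z by rewrite fr0.
have a_table i : heap (exec copy_in s) (cell Z 1 i) = 0.
  by rewrite in2 // => j _ /cell_inj[].
move: (exec copy_in s) a0 a1 a_table input => {in1 in2} sA a0 a1 a_table input.
have cl : coords_lt n Z f g.
  split=> [p pn|q q0].
    by have := is_perm_nth ps pn; move: nZ pn; rewrite /f /n /nregs; clear; lia.
  have qm : q < size tau by rewrite ltnNge; apply: contra q0 => ?; rewrite /g nth_default.
  by have := is_perm_nth pt qm; move: nZ qm; rewrite /g /n /nregs; clear; lia.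
have hi : holds_inputs n Z f g (heap sA).
  split=> [p pn|q _]; rewrite input //= nth_cat; first by rewrite pn.
  by rewrite ltnNge leq_addr /= addKn.
have st := fill_correct cl a0 a1 hi a_table.
have b0 : reg (exec fill sA) 0 = n by rewrite fr0.
have b1 : reg (exec fill sA) 1 = Z by rewrite fr0.
move: (exec fill sA) b0 b1 st => sB b0 b1 st.
have lt : size sigma + size tau < Z.-1 by move: nZ; rewrite /n /nregs; clear; lia.
have [qs [sq aq tq lcp]] := stage_max ps pt sep lt st.
have nZ2 : n <= Z by move: nZ; clear; lia.
have Z0 : 0 < Z by move: nZ; clear; lia.
have [e1 e2] := extract_correct b0 b1 nZ2 Z0 sq aq tq.
have c0 : reg (exec extract sB) 0 = n by rewrite fr0.
have c1 : reg (exec extract sB) 1 = Z by rewrite fr0.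
have hC p : p < n -> heap (exec extract sB) (cell Z 0 (2 + p)) = f p.
  by move=> pn; rewrite e2; [case: st => -[H _] _ _; apply: H | move=> j /cell_inj[]].
move: (exec extract sB) c0 c1 hC e1 => {e2} sC c0 c1 hC e1.
have [k1 k2] := exec_rank c0 c1 hC e1.
rewrite -(ltn_sortedE sq aq) in k1 k2.
have d0 : reg (exec rank sC) 0 = n by rewrite fr0.
have d1 : reg (exec rank sC) 1 = Z by rewrite fr0.
move: (exec rank sC) d0 d1 k1 k2 => sD d0 d1 k1 k2.
have nZ3 : nregs + n <= Z by move: nZ; clear; lia.
have [o1 o2] := exec_copy_out d0 d1 nZ3.
have cellZ k i : Z <= cell Z k i by rewrite /cell -addnA leq_addr.
exists (standardize (map f (map fst qs))) => //.
rewrite /standardize !size_map; split.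
- by rewrite o2 // k1 size_map.
- by move=> i iq; rewrite o2 // k2 ?size_map.
- rewrite -(size_map fst) (ltn_sortedE sq aq) size_filter.
  by apply: leq_trans (count_size _ _) _; rewrite size_iota.
- by move=> i ni; rewrite o1 // o2.
Qed.

Lemma well_formed_main : well_formed main.
Proof. by []. Qed.

(** * The whole machine code *)

(* The input fills the low addresses, which the compiled code needs as registers.  Only registers 0
   and 1, the two lengths, can be overwritten at first: they give the free address
   [Z = 64 * (size sigma + size tau)], where register 0 is saved, which releases the registers needed
   to save the others at [Z + 8], [Z + 12] and so on.  The epilogue moves the output back. *)
Definition save_code (a j : nat) : program :=
  flatten [seq [:: IAdd 1 1 0; IStore 1 r] | r <- iota a j].

Definition restore_code (j : nat) : program :=
  flatten [seq [:: ILoad r 30; IAdd 30 30 31] | r <- iota 0 j].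

(** Six doublings give the factor 64. For a nonzero total length, [Z] then exceeds that length plus
    [nregs], so the arrays lie above the registers and the whole input. *)
Definition scale_code : program :=
  IAdd 1 0 1 :: nseq 6 (IAdd 1 1 1) ++ [:: IStore 1 0; IConst 0 4; IAdd 1 1 0].

(** An empty [sigma] stops the machine at once, which makes [Z] at least 64 afterwards. The last
    three instructions bring register 1 back to [Z] and reload the length of [sigma]. *)
Definition prologue : program :=
  [:: IJz 0 2; IJmp 3; IHalt] ++ scale_code ++ save_code 2 (nregs - 2) ++
  [:: IConst 0 (4 * nregs.-1); ISub 1 1 0; ILoad 0 1].

(** Registers 30 and 31 hold the pointer and the stride, so they are filled last, each from the
    address it contains. *)
Definition epilogue : program :=
  [:: IConst 31 3; IAdd 30 1 31; IConst 31 4] ++ restore_code (nregs - 2) ++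
  [:: IAdd 31 30 31; ILoad 30 30; ILoad 31 31].

Definition lcp_program : program :=
  prologue ++ code main (size prologue) ++ epilogue.

Lemma save_codeS a j : save_code a j.+1 = save_code a j ++ [:: IAdd 1 1 0; IStore 1 (a + j)].
Proof. by rewrite /save_code -[j.+1]addn1 iotaD map_cat flatten_cat. Qed.

Lemma restore_codeS j : restore_code j.+1 = restore_code j ++ [:: ILoad j 30; IAdd 30 30 31].
Proof. by rewrite /restore_code -[j.+1]addn1 iotaD map_cat flatten_cat. Qed.

Lemma save_correct a j Y m : 1 < a -> a + j <= nregs -> nregs <= Y -> m 0 = 4 -> m 1 = Y ->
  let m' := foldl effect m (save_code a j) in
  [/\ m' 0 = 4, m' 1 = Y + 4 * j,
      forall i, i < j -> m' (Y + 4 * i.+1) = m (a + i) &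
      forall b, b != 1 -> (forall i, i < j -> b <> Y + 4 * i.+1) -> m' b = m b].
Proof.
move=> a1 aj KY m0 m1; cbv zeta; elim: j aj => [|j IH] aj; first by rewrite addn0.
have [|e0 e1 H1 H2] := IH; first by rewrite (leq_trans _ aj) // leq_add2l.
rewrite save_codeS foldl_cat; move: (foldl _ _ _) e0 e1 H1 H2 => m' e0 e1 H1 H2.
have -> : foldl effect m' [:: IAdd 1 1 0; IStore 1 (a + j)] =
    upd (upd m' 1 (m' 1 + m' 0)) (m' 1 + m' 0) (upd m' 1 (m' 1 + m' 0) (a + j)) by [].
rewrite e0 e1 -addnA -mulnSr.
have ma : upd m' 1 (Y + 4 * j.+1) (a + j) = m (a + j).
  rewrite /upd ifN; last by move: a1; clear; lia.
  by apply: H2 => [|i ij E]; [move: a1; clear; lia | move: aj KY E; clear; lia].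
have big : 31 < Y + 4 * j.+1 by move: KY; rewrite /nregs; clear; lia.
rewrite ma /upd; split.
- by rewrite ifN //; move: big; clear; lia.
- by rewrite ifN //; move: big; clear; lia.
- move=> i; rewrite ltnS leq_eqVlt => /orP[/eqP->|ij]; first by rewrite eqxx.
  rewrite !ifN ?H1 //; move: KY ij; rewrite /nregs; clear; lia.
- move=> b b1 bN; rewrite ifN ?(negbTE b1); last by apply/eqP; apply: bN.
  by apply: H2 => // i ij; apply: bN; apply: ltnW.
Qed.

Lemma restore_correct j Y m : j <= nregs - 2 -> nregs <= Y -> m 30 = Y -> m 31 = 4 ->
  let m' := foldl effect m (restore_code j) in
  [/\ m' 30 = Y + 4 * j, m' 31 = 4, forall r, r < j -> m' r = m (Y + 4 * r) &
      forall b, nregs <= b -> m' b = m b].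
Proof.
move=> jK KY m30 m31; cbv zeta; elim: j jK => [|j IH] jK; first by rewrite addn0.
have [|e0 e1 H1 H2] := IH; first exact: ltnW.
rewrite restore_codeS foldl_cat; move: (foldl _ _ _) e0 e1 H1 H2 => m' e0 e1 H1 H2.
have -> : foldl effect m' [:: ILoad j 30; IAdd 30 30 31] =
    let m2 := upd m' j (m' (m' 30)) in upd m2 30 (m2 30 + m2 31) by [].
rewrite e0 H2; last by rewrite (leq_trans KY) ?leq_addr.
have jK' : j < 30 by move: jK; rewrite /nregs; clear; lia.
cbv zeta; rewrite /upd; split.
- by rewrite eqxx !ifN ?e0 ?e1 -?addnA -?mulnSr //; move: jK'; clear; lia.
- by rewrite !ifN //; move: jK'; clear; lia.
- move=> r; rewrite ltnS leq_eqVlt => /orP[/eqP->|rj].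
    by rewrite eqxx ifN //; move: jK'; clear; lia.
  by rewrite !ifN ?H1 //; move: jK' rj; clear; lia.
- by move=> b Kb; rewrite !ifN ?H2 //; move: jK' Kb; rewrite /nregs; clear; lia.
Qed.

Lemma double_correct k m : let m' := foldl effect m (nseq k (IAdd 1 1 1)) in
  m' 1 = 2 ^ k * m 1 /\ forall b, b != 1 -> m' b = m b.
Proof.
cbv zeta; elim: k m => [|k IH] m /=; first by rewrite mul1n.
have [-> H] := IH (effect m (IAdd 1 1 1)); split; first by rewrite /effect /= /upd /= addnn -mul2n mulnA expnSr.
by move=> b b1; rewrite H // /effect /= /upd (negbTE b1).
Qed.

Lemma scale_correct Z m : Z = 64 * (m 0 + m 1) -> 64 <= Z ->
  let m' := foldl effect m scale_code in
  [/\ m' 0 = 4, m' 1 = Z + 4, m' Z = m 0 & forall b, 1 < b -> b != Z -> m' b = m b].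
Proof.
move=> ZE KZ; rewrite /scale_code -[_ :: _]/([:: IAdd 1 0 1] ++ _) 2!foldl_cat.
have [d1 db] := double_correct 6 (foldl effect m [:: IAdd 1 0 1]).
cbv zeta; move: (foldl effect _ (nseq 6 _)) d1 db => m' d1 db.
have {}d1 : m' 1 = Z by rewrite d1 ZE.
have -> : foldl effect m' [:: IStore 1 0; IConst 0 4; IAdd 1 1 0] =
  let m2 := upd (upd m' (m' 1) (m' 0)) 0 4 in upd m2 1 (m2 1 + m2 0) by [].
have Z01 : (Z == 0) = false /\ (Z == 1) = false by move: KZ; clear; lia.
have [Z0 Z1] := Z01.
rewrite d1 db // /upd /= /effect /= /upd /=; split=> //.
- by rewrite eq_sym Z1 d1.
- by rewrite Z1 Z0 eqxx.
- move=> b b1 bZ; have [b0 b1'] : b != 0 /\ b != 1 by move: b1; clear; lia.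
  by rewrite (negbTE b1') (negbTE b0) (negbTE bZ) db //= /effect /= /upd (negbTE b1').
Qed.

Lemma prologue_correct p x : embeds p 0 prologue -> 0 < nth 0 x 0 -> 
  let Z := 64 * (nth 0 x 0 + nth 0 x 1) in
  nregs + size x <= Z.+2 ->
  reaches p (size prologue) (init x) (fun cfg =>
    let m := Defs.mem cfg in
    [/\ pc cfg = size prologue, m 0 = nth 0 x 0, m 1 = Z,
      forall i, 1 < i < nregs -> m (cell Z 0 i) = nth 0 x i &
      forall b, nregs <= b -> (forall i, i < nregs -> b <> cell Z 0 i) -> m b = nth 0 x b]).
Proof.
move=> em x0; cbv zeta; set Z := 64 * _ => xZ.
have KZ : 64 <= Z by rewrite /Z; move: x0; clear; lia.
have [em1 em2] := embeds_cat em.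
have /embeds_cons[i0 /embeds_cons[i1 _]] := em1.
have -> : size prologue = (size prologue - 2).+2 by [].
do 2 (apply: reaches_step; rewrite /step /= ?i0 ?i1 ?(gtn_eqF x0)).
have -> : size prologue - 2 = (size (scale_code ++ save_code 2 (nregs - 2) ++
  [:: IConst 0 (4 * nregs.-1); ISub 1 1 0; ILoad 0 1])).+1 by [].
apply: reaches_leq (leqnSn _) _; apply: reaches_straight em2 _ _ => //.
rewrite /Defs.mem 2!foldl_cat.
have [e0 e1 eZ eb] := scale_correct (m := nth 0 x) erefl KZ.
move: (foldl effect (nth 0 x) scale_code) e0 e1 eZ eb => m e0 e1 eZ eb.
have KZ4 : nregs <= Z + 4 by move: KZ; rewrite /nregs; clear; lia.
have [f0 f1 fs fb] := @save_correct 2 (nregs - 2) (Z + 4) m isT isT KZ4 e0 e1.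
move: (foldl effect m _) f0 f1 fs fb => m' f0 f1 fs fb.
have -> : foldl effect m' [:: IConst 0 (4 * nregs.-1); ISub 1 1 0; ILoad 0 1] =
  upd (upd (upd m' 0 (4 * nregs.-1)) 1 (m' 1 - 4 * nregs.-1)) 0
    (upd (upd m' 0 (4 * nregs.-1)) 1 (m' 1 - 4 * nregs.-1) (m' 1 - 4 * nregs.-1)) by [].
have -> : m' 1 - 4 * nregs.-1 = Z by rewrite f1 /nregs; clear; lia.
have mZ : m' Z = nth 0 x 0.
  rewrite fb ?eZ //; first by move: KZ; clear; lia.
  by move=> i _; clear; lia.
split=> //.
- by rewrite /upd /= !ifN //; move: KZ; clear; lia.
- move=> i /andP[i1' iK]; rewrite /upd !ifN; try by move: KZ; rewrite /cell; clear; lia.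
  have -> : cell Z 0 i = Z + 4 + 4 * (i - 2).+1 by rewrite /cell; move: i1'; clear; lia.
  rewrite fs; last by move: i1' iK; rewrite /nregs; clear; lia.
  rewrite subnKC // eb //.
  by move: KZ iK; rewrite /nregs; clear; lia.
- move=> b Kb bN; rewrite /upd !ifN; try by move: Kb; rewrite /nregs; clear; lia.
  rewrite fb; first apply: eb.
  + by move: Kb; rewrite /nregs; clear; lia.
  + by apply/eqP => E; apply: (bN 0) => //; rewrite E /cell; clear; lia.
  + by move: Kb; rewrite /nregs; clear; lia.
  + move=> i iK E; apply: (bN i.+2); first by move: iK; rewrite /nregs; clear; lia.
    by rewrite E /cell; clear; lia.
Qed.

Lemma epilogue_correct p o Z m : embeds p o epilogue -> nregs <= Z -> m 1 = Z ->
  reaches p (size epilogue) (Config o m) (fun cfg =>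
    [/\ pc cfg = o + size epilogue,
      forall r, r < nregs -> Defs.mem cfg r = m (cell Z 3 r) &
      forall b, nregs <= b -> Defs.mem cfg b = m b]).
Proof.
move=> em KZ m1; apply: reaches_straight em _ _ => //; rewrite /Defs.mem 2!foldl_cat.
have -> : foldl effect m [:: IConst 31 3; IAdd 30 1 31; IConst 31 4] =
  upd (upd (upd m 31 3) 30 (m 1 + 3)) 31 4 by [].
set m0 := upd _ 31 4.
have KZ3 : nregs <= Z + 3 by move: KZ; clear; lia.
have h30 : m0 30 = Z + 3 by rewrite /m0 /upd /= m1.
have [e0 e1 er eb] := restore_correct (leqnn _) KZ3 h30 (erefl : m0 31 = 4).
have m0b b : nregs <= b -> m0 b = m b.
  by move=> Kb; rewrite /m0 /upd !ifN //; move: Kb; rewrite /nregs; clear; lia.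
move: (foldl effect m0 _) e0 e1 er eb => m' e0 e1 er eb.
have -> : foldl effect m' [:: IAdd 31 30 31; ILoad 30 30; ILoad 31 31] =
  let a := upd m' 31 (m' 30 + m' 31) in let b := upd a 30 (a (a 30)) in
  upd b 31 (b (b 31)) by [].
cbv zeta; rewrite e0 e1.
set a := upd m' 31 _; set b := upd a 30 _.
have a30 : a 30 = Z + 3 + 4 * 30 by rewrite /a /upd /= e0.
have b31 : b 31 = Z + 3 + 4 * 31 by rewrite /b /a /upd /= -addnA.
have bK r : nregs <= r -> b r = m r.
  move=> Kr; rewrite /b /a /upd !ifN ?eb ?m0b //; move: Kr; rewrite /nregs; clear; lia.
have cellE r : Z + 3 + 4 * r = cell Z 3 r by rewrite /cell; clear; lia.
have Kc r : nregs <= cell Z 3 r by rewrite -cellE (leq_trans KZ3) // leq_addr.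
split=> // r rK; rewrite /upd; last first.
  by rewrite ifN ?bK //; move: rK; rewrite /nregs; clear; lia.
rewrite b31 cellE; case: eqP => [->|/eqP r31]; first by rewrite bK.
rewrite /b {1}/upd a30; case: eqP => [->|/eqP r30].
  by rewrite cellE /a /upd ifN ?eb ?m0b //; move: (Kc 30); rewrite /nregs; clear; lia.
rewrite /a /upd (negbTE r31) er; last by move: rK r31 r30; rewrite /nregs; clear; lia.
by rewrite cellE m0b.
Qed.

Lemma halted_step p c : halted p c -> step p c = c.
Proof. by rewrite /halted /step; case: (nth _ _ _). Qed.

Lemma halted_iter p c t : halted p c -> iter t (step p) c = c.
Proof. by move=> hc; elim: t => //= t ->; apply: halted_step. Qed.

Lemma reaches_run p N x (Q : config -> Prop) T :
  reaches p N (init x) (fun cfg => halted p cfg /\ Q cfg) -> N <= T ->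
  halted p (run p x T) /\ Q (run p x T).
Proof.
case=> t tN [ht Qt] NT; rewrite /run -(subnK (leq_trans tN NT)) iterD.
by rewrite halted_iter.
Qed.

Lemma program_correct sigma tau : is_perm sigma -> is_perm tau -> separable sigma ->
  reaches lcp_program
    (size prologue + (steps (64 * (size sigma + size tau)) main + size epilogue)).+1
    (init (encode sigma tau))
    (fun cfg => halted lcp_program cfg /\ is_LCP (output cfg) sigma tau).
Proof.
move=> ps pt sep; set x := encode sigma tau; set Z := 64 * _.
have em : embeds lcp_program 0 lcp_program by [].
have [em1 /embeds_cat[em2 em3]] := embeds_cat em.
(* The program ends by running past its last instruction, where the default of [nth] is [IHalt]. *)
have hend : nth IHalt lcp_program (size prologue + size (code main (size prologue)) + size epilogue) = IHalt.
  by rewrite nth_default // /lcp_program !size_cat addnA.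
move: lcp_program {em} em1 em2 em3 hend => p em1 em2 em3 hend.
(* If [sigma] is empty, the 0 in register 0 is already the length of the output. *)
have [n0|n0] := posnP (size sigma).
  have /embeds_cat[/embeds_cons[i0 /embeds_cons[_ /embeds_cons[i2 _]]] _] := em1.
  rewrite -addnS; apply: reaches_leq (leq_addr _ _) _.
  have -> : size prologue = (size prologue).-1.+1 by [].
  apply: reaches_step; rewrite /step /= i0 /= n0 /=; apply: reaches0.
  split; first by rewrite /halted /= i2.
  rewrite /output /= n0 (size0nil n0); split=> //.
  - by exists [::].
  - by exists [::] => //; exact: sub0seq.
  - by move=> rho _ [s /size_subseq + [-> _]] _; rewrite leqn0 => /eqP->.
apply: reaches_leq (leqnSn _) _.
apply: reaches_trans.
  apply: (prologue_correct (x := x) em1) => //=.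
  by rewrite size_cat /nregs; move: n0; clear; lia.
rewrite -[nth 0 x 0]/(size sigma) -[nth 0 x 1]/(size tau) -/Z.
case=> k m /= [-> m0 m1 mlow mhigh].
have KZ : nregs + size sigma + size tau < Z by rewrite /Z /nregs; move: n0; clear; lia.
have xZ : size x <= Z by rewrite /x /= size_cat /Z; move: n0; clear; lia.
pose s := State m m.
have KZ' : nregs <= Z by move: KZ; clear; lia.
have hz i : nregs <= i -> m (cell Z 0 i) = 0.
  move=> Ki; rewrite mhigh.
  - by rewrite nth_default // (leq_trans xZ) // /cell -addnA leq_addr.
  - by rewrite (leq_trans KZ') // /cell -addnA leq_addr.
  - by move=> j jK /cell_inj[]// _ E; move: jK; rewrite -E ltnNge Ki.
have ht i : m (cell Z 1 i) = 0.
  rewrite mhigh.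
  - by rewrite nth_default // (leq_trans xZ) // /cell -addnA leq_addr.
  - by rewrite (leq_trans KZ') // /cell -addnA leq_addr.
  - by move=> j jK /cell_inj[].
have hi i : nregs <= i < Z -> m i = nth 0 x i.
  case/andP=> Ki iZ; apply: mhigh => // j _ E.
  by move: iZ; rewrite E /cell; clear; lia.
have [rho lcp [h0 h1 h2 h3]] := @main_correct sigma tau Z s ps pt sep m0 m1 KZ mlow hi hz ht.
have c1 : nregs <= reg s 1 by rewrite [reg s 1]m1.
have c0 : reg s 0 <= Z by rewrite [reg s 0]m0; move: KZ; clear; lia.
have c2 : reg s 1 <= Z by rewrite [reg s 1]m1.
have sim : simulates s m by [].
apply: reaches_trans (code_correct well_formed_main c1 c0 c2 em2 sim) _.
case=> k' m' [pcE [sr sh]]; rewrite /pc in pcE; rewrite /Defs.mem in sr sh; rewrite pcE.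
have m'1 : m' 1 = Z by rewrite sr // well_formed_frame // well_formed_main.
move: (size (code main _)) em3 hend => o em3 hend.
have [t tN [pce er eb]] := epilogue_correct em3 KZ' m'1.
exists t; first exact: tN.
move: (iter t _ _) pce er eb => [k2 m2]; rewrite /pc /Defs.mem => -> er eb.
split; first by rewrite /halted /pc -[X in nth _ _ X]/(size prologue + o + size epilogue) hend.
have cK i : nregs <= cell Z 3 i by rewrite (leq_trans KZ') // /cell -addnA leq_addr.
have out i : i <= size sigma -> m2 i = heap (exec main s) (cell Z 3 i).
  move=> ni; have [iK|Ki] := ltnP i nregs; first by rewrite er // sh.
  rewrite eb // sh //; have := h3 (i - nregs); rewrite subnKC //; apply.
  by move: Ki ni; rewrite /nregs; clear; lia.
suff E : output (Config 0 m2) = rho by rewrite -[output _]/(output (Config 0 m2)) E.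
rewrite /output /Defs.mem out // h0; apply: (@eq_from_nth _ 0); first by rewrite size_mkseq.
move=> i; rewrite size_mkseq => ir; rewrite nth_mkseq // out ?h1 //.
exact: leq_trans ir h2.
Qed.

Theorem theorem1 :
  exists (p : program) (c k : nat),
    forall sigma tau : seq nat,
      is_perm sigma -> is_perm tau -> separable sigma ->
      let cfg := run p (encode sigma tau) (c * (size sigma + size tau).+1 ^ k) in
      halted p cfg /\ is_LCP (output cfg) sigma tau.
Proof.
have [C [k bound]] := steps_poly main.
(* The factor [64 ^ k] comes from [Z]: with [S] the total length, [64 * S + 1 <= 64 * (S + 1)]. *)
exists lcp_program, (size prologue + (C * 64 ^ k + size epilogue)).+1, k.
move=> sigma tau ps pt sep; apply: reaches_run (program_correct ps pt sep) _.
set S := size sigma + size tau.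
have S1 : 0 < S.+1 ^ k by rewrite expn_gt0.
have : steps (64 * S) main <= C * 64 ^ k * S.+1 ^ k.
  apply: leq_trans (bound _) _; rewrite -mulnA -expnMn leq_mul2l; apply/orP; right.
  have [->|k0] := posnP k; first by rewrite !expn0.
  by rewrite leq_exp2r //; clear; lia.
move: (steps _ _) (size prologue) (size epilogue) => a b d ale.
rewrite mulSn -add1n !mulnDl; apply: leq_add => //; apply: leq_add; first exact: leq_pmulr.
by apply: leq_add => //; apply: leq_pmulr.
Qed.
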